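(* Let $(X,\bullet)$ be a pointed, path-connected diffeological space, and let $\Theta$ be the universal connection on the pointed path bundle $\tau:\mathcal F_\bullet(X)\to X$. Given a smooth path $\alpha:(a,b)\to X$, an initial time $t_0\in(a,b)$, and an initial path $[\beta_0]\in\tau^{-1}(\alpha(t_0))$, define $\bar\alpha_{\beta_0}:(a,b)\to\mathcal F_\bullet(X)$ by $$\bar\alpha_{\beta_0}(s)=[\alpha^{t_0\to s}\vee\beta_0].$$ Then $\mathrm{hor}_\Theta(\alpha,t_0,[\beta_0])=\bar\alpha_{\beta_0}$.
   Context: Diffeology. Diffeological spaces, plots, smooth maps, and the subspace, product, quotient and functional diffeologies are the standard ones; $[0,1]\subseteq\mathbb R$ has the subspace diffeology. A diffeological group is a group with a diffeology making multiplication and inversion smooth. For a diffeological space $(Y,\mathcal D)$, $\mathcal D$ carries the functional diffeology: $r\mapsto\psi_r$ ($r\in U$) is a plot iff for all $r_0\in U$, $s_0\in\mathrm{dom}(\psi_{r_0})$ there are open neighborhoods $V\subseteq U$ of $r_0$ and $W\subseteq\mathrm{dom}(\psi_{r_0})$ of $s_0$ with $W\subseteq\mathrm{dom}(\psi_r)$ for all $r\in V$ and $(r,s)\mapsto\psi_r(s)$ a plot on $V\times W$. $\mathcal PY\subseteq\mathcal D$ is the subspace of plots defined on open intervals of $\mathbb R$ (smooth paths), and $\hat{\mathcal P}Y=\{(\alpha,t)\in\mathcal PY\times\mathbb R: t\in\mathrm{dom}(\alpha)\}$ with the subspace diffeology. $X$ is path-connected if any two points lie in the image of some $\alpha\in\mathcal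 PX$. Bundles and connections. For a diffeological group $G$, a diffeological principal $G$-bundle is a smooth surjection $\pi:E\to X$ with a smooth right $G$-action on $E$ such that $E\times G\to E\times E$, $(p,g)\mapsto(p,pg)$, is a diffeomorphism onto its image, and there is a diffeomorphism $X\to E/G$ sending $\pi(\xi)$ to $\xi\cdot G$ for all $\xi\in E$. A diffeological connection on it is a smooth map $A:\hat{\mathcal P}E\to\mathcal PE$, $(\tilde\alpha,t)\mapsto A_t\tilde\alpha$, with: (i) $\mathrm{dom}(A_t\tilde\alpha)=\mathrm{dom}(\tilde\alpha)$; (ii) $\pi\circ A_t\tilde\alpha=\pi\circ\tilde\alpha$; (iii) $A_t\tilde\alpha(t)=\tilde\alpha(t)$; (iv) $A_t(\tilde\alpha\cdot\rho)=A_t\tilde\alpha\cdot\rho(t)$ for every smooth path $\rho:\mathrm{dom}(\tilde\alpha)\to G$; (v) $A_t(\tilde\alpha\circ f)=A_{f(t)}\tilde\alpha\circ f$ for $f\in\mathcal P(\mathrm{dom}(\tilde\alpha))$; (vi) $A_t(A_t\tilde\alpha)=A_t\tilde\alpha$. A path $\tilde\alpha\in\mathcal PE$ is $A$-horizontal if $A_t\tilde\alpha=\tilde\alpha$ for some $t$. For $\alpha\in\mathcal PX$, $t\in\mathrm{dom}(\alpha)$, $\xi\in\pi^{-1}(\alpha(t))$ the horizontal lift $\mathrm{hor}_A(\alpha,t,\xi)\in\mathcal PE$ is the $A$-horizontal path $A_t\tilde\alpha$, for any $\tilde\alpha\in\mathcal PE$ with $\pi\circ\tilde\alpha=\alpha$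 and $\tilde\alpha(t)=\xi$ (independent of the choice); it lies over $\alpha$ and takes the value $\xi$ at $t$. Path spaces. $C^\infty([0,1],X)$ has the functional diffeology. Let $C^\infty_\sim([0,1],X)=C^\infty([0,1],X)/\!\sim$, where $\alpha\sim\beta$ iff there is $f\in\mathrm{Diff}([0,1])$ with $f(0)=0$, $f(1)=1$ and $\alpha=\beta\circ f$; the class of $\alpha$ is $\ulcorner\alpha\urcorner$. For $\alpha,\beta$ with $\beta(0)=\alpha(1)$, the concatenation is $(\beta\vee\alpha)(t)=\alpha(2t)$ for $t<1/2$ and $\beta(2t-1)$ for $t\ge1/2$, and $\ulcorner\beta\urcorner\vee\ulcorner\alpha\urcorner=\ulcorner\beta\vee\alpha\urcorner$, with representatives chosen constant near $0$ and $1$. Retrace equivalence is the equivalence relation on $C^\infty_\sim([0,1],X)$ generated by the operations $\ulcorner\beta\urcorner\vee\ulcorner\alpha\urcorner\mapsto\ulcorner\beta\urcorner\vee\ulcorner\eta\urcorner\vee\ulcorner\eta^{\leftarrow}\urcorner\vee\ulcorner\alpha\urcorner$ for $\ulcorner\eta\urcorner\in C^\infty_\sim([0,1],X)$, where $\eta^{\leftarrow}(t)=\eta(1-t)$. $\mathcal F(X)$ is the quotient of $C^\infty_\sim([0,1],X)$ by retrace equivalence, with the quotient diffeology; the class of $\alpha\in C^\infty([0,1],X)$ is $[\alpha]$. By convention, the representative $\alpha$ of a given $[\alpha]\in\mathcal F(X)$ is assumed constant near $0$ and $1$, and $[\beta]\vee[\alpha]=[\beta\vee\alpha]$ for classes with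 $\beta(0)=\alpha(1)$. $\mathcal F_\bullet(X)=\{[\alpha]:\alpha(0)=\bullet\}$ and $\Omega_\bullet(X)=\{[\gamma]:\gamma(0)=\bullet=\gamma(1)\}$ have the subspace diffeology; $\Omega_\bullet(X)$ is a diffeological group under $\vee$ with $[\gamma]^{-1}=[\gamma^{\leftarrow}]$, acting on $\mathcal F_\bullet(X)$ on the right by $[\alpha]\vee[\gamma]$, and $\tau:\mathcal F_\bullet(X)\to X$, $\tau([\alpha])=\alpha(1)$, is a diffeological principal $\Omega_\bullet(X)$-bundle (the pointed path bundle). For a path $c$ on an open interval and $r,s$ in it, $c^{r\to s}:[0,1]\to X$ is $c^{r\to s}(t)=c(ts+(1-t)r)$. The universal connection is $\Theta:\hat{\mathcal P}\mathcal F_\bullet(X)\to\mathcal P\mathcal F_\bullet(X)$, $\Theta_r[\tilde\alpha](s)=[(\tau\circ[\tilde\alpha])^{r\to s}\vee\tilde\alpha(r)]$, where $[\tilde\alpha]$ denotes the smooth path $s\mapsto[\tilde\alpha(s)]$; it is a diffeological connection on $\tau$.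
   Formalization: As α^{t0→s} need not be constant near 0 and 1, its concatenation with β0 is undefined; in both Θ and ᾱ it is first precomposed with one arbitrary smooth φ:[0,1]→[0,1], 0 near 0 and 1 near 1; F_•(X) consists of classes having a representative constant near 0 and 1. *)

(* Defs.v *)
From HB Require Import structures.
From mathcomp Require Import all_boot all_order all_algebra.
From mathcomp Require Import boolp classical_sets functions reals.
From mathcomp Require Import topology normedtype landau derive.
From mathcomp Require Import lra.
From Stdlib Require Import Relation_Operators.

Import Order.TTheory GRing.Theory Num.Theory numFieldNormedType.Exports.

Set Implicit Arguments.
Unset Strict Implicit.
Unset Printing Implicit Defensive.

Local Open Scope ring_scope.
Local Open Scope classical_set_scope.

Section Smooth.
Context {R : realType}.

(* k times Frechet differentiable on U, expressed through the successive
   directional derivatives; U is open in all uses. *)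
Fixpoint kdiff (V W : normedModType R) (k : nat) (U : set V) (f : V -> W) :=
  if k is k'.+1 then
    (forall x, U x -> differentiable f x) /\
    (forall v, kdiff k' U (fun x => 'd f x v))
  else True.

Definition smooth_on (V W : normedModType R) (U : set V) (f : V -> W) :=
  forall k, kdiff k U f.

Lemma near_eq_diff (V W : normedModType R) (f g : V -> W) x :
  (\near x, f x = g x) -> differentiable f x ->
  differentiable g x /\ 'd g x = 'd f x :> (V -> W).
Proof.
move=> fg df.
have fgx : f x = g x by apply: nbhs_singleton fg.
have [cd /eqaddoP H] := (diff_locallyP x f).1 df.
have G : g \o shift x = cst (g x) + 'd f x +o_ 0 id.
  apply/eqaddoP => e e0; have := H e e0.
  have : \forall y \near (0 : V), f (y + x) = g (y + x).
    have : shift x @ (0 : V) --> x.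
      by rewrite -[X in _ --> X]add0r; apply: cvgD; [exact: cvg_id|exact: cvg_cst].
    by move/(_ _ fg).
  by apply: filterS2 => y /= fgy; rewrite !fctE /= fgy fgx.
have E : 'd g x = 'd f x :> (V -> W) by have /= -> := diff_unique cd G.
split=> //; apply/diff_locallyP; rewrite E; split=> //.
Qed.

Lemma kdiff_eq (V W : normedModType R) k (U : set V) (f g : V -> W) :
  open U -> (forall x, U x -> f x = g x) -> kdiff k U f -> kdiff k U g.
Proof.
move=> oU; elim: k f g => //= k IH f g fg [df ddf].
have H x : U x -> differentiable g x /\ 'd g x = 'd f x :> (V -> W).
  move=> Ux; apply: near_eq_diff (df _ Ux).
  by apply: filterS (open_nbhs_nbhs (conj oU Ux)) => y Uy; apply: fg.
split=> [x /H[]//|v]; apply: IH (ddf v) => x Ux /=.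
by have [_ ->] := H _ Ux.
Qed.

Lemma kdiff_sub (V W : normedModType R) k (U U' : set V) (f : V -> W) :
  U' `<=` U -> kdiff k U f -> kdiff k U' f.
Proof.
by move=> sU; elim: k f => //= k IH f [df ddf]; split=> [x /sU/df//|v]; apply: IH.
Qed.

Lemma kdiffS (V W : normedModType R) k (U : set V) (f : V -> W) :
  kdiff k.+1 U f -> kdiff k U f.
Proof.
elim: k f => // k IH f [df ddf]; split=> // v; exact: IH (ddf v).
Qed.

Lemma kdiff_cst (V W : normedModType R) k (U : set V) (c : W) :
  kdiff k U (fun=> c).
Proof.
elim: k c => //= k IH c; split=> [x _|v]; first exact: differentiable_cst.
rewrite (_ : (fun _ => _) = (fun=> 0)); first exact: IH.
by apply/funext => x; have /= -> := @diff_cst R V W c x.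
Qed.

Lemma kdiffD (V W : normedModType R) k (U : set V) (f g : V -> W) : open U ->
  kdiff k U f -> kdiff k U g -> kdiff k U (fun x => f x + g x).
Proof.
move=> oU; elim: k f g => //= k IH f g [df ddf] [dg ddg].
split=> [x Ux|v]; first exact: differentiableD (df _ Ux) (dg _ Ux).
apply: kdiff_eq oU _ (IH _ _ (ddf v) (ddg v)) => x Ux /=.
by have /= -> := diffD (df _ Ux) (dg _ Ux).
Qed.

Lemma kdiff_sum (V W : normedModType R) k (U : set V) n (F : 'I_n -> V -> W) :
  open U -> (forall i, kdiff k U (F i)) -> kdiff k U (fun x => \sum_i F i x).
Proof.
move=> oU; elim: n F => [|n IH] F H.
  by apply: kdiff_eq oU _ (@kdiff_cst V W k U 0) => x _; rewrite big_ord0.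
have := kdiffD oU (IH (fun i => F (widen_ord (leqnSn n) i)) (fun i => H _)) (H ord_max).
by apply: (kdiff_eq oU) => x _; rewrite big_ord_recr.
Qed.

Lemma kdiffM (V : normedModType R) k (U : set V) (f g : V -> R) : open U ->
  kdiff k U f -> kdiff k U g -> kdiff k U (fun x => f x * g x).
Proof.
move=> oU; elim: k f g => // k IH f g kf kg.
have [df ddf] := kf; have [dg ddg] := kg.
split=> [x Ux|v]; first exact: differentiableM (df _ Ux) (dg _ Ux).
apply: kdiff_eq oU _ (kdiffD oU (IH _ _ (kdiffS kf) (ddg v))
  (IH _ _ (kdiffS kg) (ddf v))) => x Ux /=.
by have /= -> := diffM (df _ Ux) (dg _ Ux).
Qed.

Lemma kdiff_lin (V W Z : normedModType R) k (U : set V) (f : V -> W)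
    (L : {linear W -> Z}) : open U -> continuous L ->
  kdiff k U f -> kdiff k U (fun x => L (f x)).
Proof.
move=> oU cL; elim: k f => //= k IH f [df ddf].
have dL y : differentiable L y by exact: linear_differentiable.
split=> [x Ux|v]; first exact: differentiable_comp (df _ Ux) (dL _).
apply: kdiff_eq oU _ (IH _ (ddf v)) => x Ux /=.
have /= -> := diff_comp (df _ Ux) (dL _).
by have /= -> := diff_lin (f x) cL.
Qed.

Lemma kdiff_id (V : normedModType R) k (U : set V) : kdiff k U (@idfun V).
Proof.
case: k => //= k; split=> [x _|v]; first by have [] := is_diff_id x.
rewrite (_ : (fun _ => _) = (fun=> v)); first exact: kdiff_cst.
by apply/funext => x; have [_ /= ->] := is_diff_id x.
Qed.

Lemma kdiff_coord (V : normedModType R) m n k (U : set V) (f : V -> 'M[R]_(m, n)) i j :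
  open U -> kdiff k U f -> kdiff k U (fun x => f x i j).
Proof.
move=> oU kf.
have lc : linear (fun M : 'M[R]_(m, n) => M i j : R^o).
  by move=> a u v; rewrite !mxE.
pose L := GRing.isLinear.Build _ _ _ _ _ lc.
pose C : {linear 'M[R]_(m, n) -> R} := HB.pack (fun M : 'M[R]_(m, n) => M i j : R^o) L.
exact: (@kdiff_lin _ _ _ _ _ f C oU (@coord_continuous _ _ _ i j) kf).
Qed.

Lemma kdiff_scalel (V W : normedModType R) k (U : set V) (f : V -> R) (w : W) :
  open U -> kdiff k U f -> kdiff k U (fun x => f x *: w).
Proof.
move=> oU kf.
have lc : linear (fun a : R^o => a *: w).
  by move=> a u v; rewrite scalerDl scalerA.
pose L := GRing.isLinear.Build _ _ _ _ _ lc.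
pose C : {linear R -> W} := HB.pack (fun a : R^o => a *: w) L.
exact: (@kdiff_lin _ _ _ _ _ f C oU (@scalel_continuous _ _ w) kf).
Qed.

Lemma kdiff_comp_real (V : normedModType R) n k (U : set V) (U' : set 'rV[R]_n)
    (f : V -> 'rV[R]_n) (g : 'rV[R]_n -> R) : open U -> open U' ->
  (forall x, U x -> U' (f x)) ->
  kdiff k U f -> kdiff k U' g -> kdiff k U (fun x => g (f x)).
Proof.
move=> oU oU' fU; elim: k f g fU => // k IH f g fU kf kg.
have [df ddf] := kf; have [dg ddg] := kg.
split=> [x Ux|v]; first exact: differentiable_comp (df _ Ux) (dg _ (fU _ Ux)).
have := kdiff_sum oU (fun i : 'I_n => kdiffM oU
  (kdiff_coord 0 i oU (ddf v)) (IH _ _ fU (kdiffS kf) (ddg (delta_mx 0 i)))).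
apply: (kdiff_eq oU) => x Ux /=.
have /= -> := diff_comp (df _ Ux) (dg _ (fU _ Ux)).
rewrite [X in _ = 'd g _ X]row_sum_delta linear_sum.
by apply: eq_bigr => i _; rewrite linearZ.
Qed.

Lemma kdiff_comp (V : normedModType R) m n k (U : set V) (U' : set 'rV[R]_n)
    (f : V -> 'rV[R]_n) (g : 'rV[R]_n -> 'rV[R]_m) : open U -> open U' ->
  (forall x, U x -> U' (f x)) ->
  kdiff k U f -> kdiff k U' g -> kdiff k U (fun x => g (f x)).
Proof.
move=> oU oU' fU kf kg.
have := kdiff_sum oU (fun i : 'I_m => kdiff_scalel (delta_mx 0 i : 'rV[R]_m) oU
  (kdiff_comp_real oU oU' fU kf (kdiff_coord 0 i oU' kg))).
by apply: (kdiff_eq oU) => x Ux; rewrite [RHS]row_sum_delta.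
Qed.

Lemma smooth_continuous (V W : normedModType R) (U : set V) (f : V -> W) x :
  smooth_on U f -> U x -> {for x, continuous f}.
Proof. by move=> /(_ 1%N)[df _] /df; exact: differentiable_continuous. Qed.

End Smooth.

(* Parametrizations are partial functions, encoded with option, so that two of
   them are equal exactly when they have the same domain and the same values. *)
Definition pdom (A X : Type) (f : A -> option X) : set A := [set x | isSome (f x)].

Definition prestr (A X : Type) (V : set A) (f : A -> option X) : A -> option X :=
  fun x => if `[< V x >] then f x else None.

Lemma prestrT (A X : Type) (V : set A) (f : A -> option X) x :
  V x -> prestr V f x = f x.
Proof. by move=> Vx; rewrite /prestr (asboolT Vx). Qed.

Lemma prestrF (A X : Type) (V : set A) (f : A -> option X) x :
  ~ V x -> prestr V f x = None.
Proof. by move=> Vx; rewrite /prestr (asboolF Vx). Qed.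

Lemma pdom_restr (A X : Type) (V : set A) (f : A -> option X) :
  pdom (prestr V f) = V `&` pdom f.
Proof.
apply/funext => x; apply/propext; rewrite /pdom /=.
have [Vx|Vx] := pselect (V x); first by rewrite prestrT //; split=> [|[]].
by rewrite prestrF //; split=> // -[].
Qed.

Lemma prestr_omap (A X Y : Type) (V : set A) (f : A -> option X) (g : X -> Y) :
  omap g \o prestr V f = prestr V (omap g \o f).
Proof. by apply/funext => x; rewrite /prestr /=; case: asbool. Qed.

Lemma pdom_omap (A X Y : Type) (f : A -> option X) (g : X -> Y) :
  pdom (omap g \o f) = pdom f.
Proof. by apply/funext => x; rewrite /pdom /=; case: (f x). Qed.

Lemma prestr_dom (A X : Type) (V : set A) (f : A -> option X) :
  pdom f `<=` V -> prestr V f = f.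
Proof.
move=> fV; apply/funext => x; have [Vx|Vx] := pselect (V x); first exact: prestrT.
rewrite prestrF //; case E : (f x) => [y|//].
by case: Vx; apply: fV; rewrite /pdom /= E.
Qed.

Lemma prestr_id (A X : Type) (V : set A) (f : A -> option X) :
  prestr V f = prestr (V `&` pdom f) f.
Proof.
apply/funext => x; have [[Vx fx]|nV] := pselect ((V `&` pdom f) x).
  by rewrite !prestrT //; split.
rewrite [RHS]prestrF //; have [Vx|Vx] := pselect (V x); last exact: prestrF.
rewrite prestrT //; case E : (f x) => [y|//].
by case: nV; split=> //; rewrite /pdom /= E.
Qed.

Lemma prestr_prestr (A X : Type) (V W : set A) (f : A -> option X) :
  prestr V (prestr W f) = prestr (V `&` W) f.
Proof.
apply/funext => x; have [Vx|Vx] := pselect (V x); last first.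
  by rewrite !prestrF // => -[].
rewrite prestrT //; have [Wx|Wx] := pselect (W x).
  by rewrite !prestrT //; split.
by rewrite !prestrF // => -[].
Qed.

Section Diffeology.
Context {R : realType}.

Record diffSpace := DiffSpace {
  carrier :> Type;
  plot : forall n, ('rV[R]_n -> option carrier) -> Prop;
  plot_open : forall n (f : 'rV[R]_n -> option carrier),
    plot f -> open (pdom f);
  plot_cst : forall n (x : carrier), plot (fun _ : 'rV[R]_n => Some x);
  plot_loc : forall n (f : 'rV[R]_n -> option carrier),
    (forall r, pdom f r -> exists2 V, open_nbhs r V & plot (prestr V f)) ->
    plot f;
  plot_comp : forall m n (f : 'rV[R]_n -> option carrier)
      (V : set 'rV[R]_m) (h : 'rV[R]_m -> 'rV[R]_n),
    plot f -> open V -> smooth_on V h -> (forall r, V r -> pdom f (h r)) ->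
    plot (prestr V (fun r => f (h r))) }.

Lemma plot_restr (X : diffSpace) n (f : 'rV[R]_n -> option X) V :
  plot f -> open V -> plot (prestr V f).
Proof.
move=> pf oV; rewrite prestr_id.
apply: (@plot_comp X n n f (V `&` pdom f) idfun pf).
- exact: openI oV (plot_open pf).
- by move=> k; apply: kdiff_id.
- by move=> r [].
Qed.

Lemma open_pdom_loc (Y : Type) n (f : 'rV[R]_n -> option Y) :
  (forall r, pdom f r ->
    exists2 V : set 'rV[R]_n, open_nbhs r V & open (pdom (prestr V f))) ->
  open (pdom f).
Proof.
move=> H; rewrite openE => r fr; have [V [oV Vr]] := H r fr.
rewrite pdom_restr => oVf.
have := open_nbhs_nbhs (conj oVf (conj Vr fr)).
by apply: filterS => y [].
Qed.

Definition smooth_map (X Y : diffSpace) (f : X -> Y) :=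
  forall n (p : 'rV[R]_n -> option X), plot p -> plot (omap f \o p).

Lemma kdiff_loc (V W : normedModType R) k (U : set V) (f : V -> W) :
  (forall x, U x -> exists2 A, open_nbhs x A & kdiff k (A `&` U) f) ->
  kdiff k U f.
Proof.
elim: k f => //= k IH f H; split=> [x Ux|v].
  by have [A [oA Ax] [df _]] := H x Ux; apply: df.
by apply: IH => x Ux; have [A oA [_ ddf]] := H x Ux; exists A.
Qed.

Definition real_plot n (p : 'rV[R]_n -> option R) :=
  open (pdom p) /\ smooth_on (pdom p) (fun r => odflt 0 (p r)).

Lemma real_plot_cst n (x : R) : real_plot (fun _ : 'rV[R]_n => Some x).
Proof.
split=> [|k]; last exact: kdiff_cst.
by rewrite (_ : pdom _ = setT); [exact: openT|apply/funext => r; apply/propext].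
Qed.

Lemma real_plot_loc n (f : 'rV[R]_n -> option R) :
  (forall r, pdom f r -> exists2 V, open_nbhs r V & real_plot (prestr V f)) ->
  real_plot f.
Proof.
move=> H; have of_ : open (pdom f).
  by apply: open_pdom_loc => r /H[V oV []]; exists V.
split=> // k; apply: kdiff_loc => r /H[V [oV Vr] [oVf sVf]]; exists V => //.
have := sVf k; rewrite pdom_restr; apply: kdiff_eq; first exact: openI.
by move=> x [Vx _]; rewrite prestrT.
Qed.

Lemma real_plot_comp m n (f : 'rV[R]_n -> option R)
      (V : set 'rV[R]_m) (h : 'rV[R]_m -> 'rV[R]_n) :
    real_plot f -> open V -> smooth_on V h -> (forall r, V r -> pdom f (h r)) ->
    real_plot (prestr V (fun r => f (h r))).
Proof.
move=> [of_ sf] oV sh hV; rewrite /real_plot.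
have -> : pdom (prestr V (fun r => f (h r))) = V.
  by rewrite pdom_restr; apply/funext => r; apply/propext; split=> [[]|Vr] //; split=> //; exact: hV.
split=> // k; apply: kdiff_eq oV _ (kdiff_comp_real oV of_ hV (sh k) (sf k)) => r Vr.
by rewrite prestrT.
Qed.

Definition real_diff : diffSpace :=
  @DiffSpace R real_plot (fun n f => @proj1 _ _) real_plot_cst real_plot_loc
    real_plot_comp.

Definition sub_diff (X : diffSpace) (P : set X) : diffSpace.
Proof.
refine (@DiffSpace {x : X | P x}
  (fun n p => plot (omap sval \o p)) _ _ _ _).
- by move=> n f /plot_open; rewrite pdom_omap.
- by move=> n x; exact: plot_cst (sval x).
- move=> n f H; apply: plot_loc => r; rewrite pdom_omap => /H[V oV].
  by rewrite prestr_omap; exists V.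
- move=> m n f V h pf oV sh hV; rewrite prestr_omap.
  by apply: (plot_comp pf) => // r; rewrite pdom_omap => /hV.
Defined.

Section Quotient.
Variables (X : diffSpace) (r : X -> X -> Prop).

(* Equivalence classes; r is an equivalence relation in all uses. *)
Definition quot := {A : set X | exists x, A = r x}.

Definition qcls (x : X) : quot := exist _ (r x : set X) (ex_intro _ x erefl).

Lemma qcls_surj (c : quot) : exists x, c = qcls x.
Proof. by case: c => A [x Ax]; exists x; apply: eq_exist. Qed.

Definition quot_plot n (p : 'rV[R]_n -> option quot) :=
  forall s, pdom p s -> exists (V : set 'rV[R]_n) (q : 'rV[R]_n -> option X),
    [/\ open_nbhs s V, plot q & prestr V p = omap qcls \o q].

Lemma quot_plot_open n (p : 'rV[R]_n -> option quot) :
  quot_plot p -> open (pdom p).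
Proof.
move=> H; apply: open_pdom_loc => s /H[V [q [oV pq E]]]; exists V => //.
by rewrite E pdom_omap; exact: plot_open.
Qed.

Definition quot_diff : diffSpace.
Proof.
refine (@DiffSpace quot quot_plot quot_plot_open _ _ _).
- move=> n c s _; have [x ->] := qcls_surj c.
  exists setT, (fun=> Some x); split.
  + by split=> //; exact: openT.
  + exact: plot_cst.
  + by rewrite prestr_dom.
- move=> n f H s fs; have [V [oV Vs] /(_ s)] := H s fs.
  rewrite pdom_restr => /(_ (conj Vs fs))[W [q [[oW Ws] pq E]]].
  exists (W `&` V), q; split=> //.
    by split; [exact: openI|].
  by rewrite -E prestr_prestr.
- move=> m n f V h pf oV sh hV s; rewrite pdom_restr => -[Vs fs].
  have [W [q [[oW Ws] pq E]]] := pf _ fs.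
  have oVW : open (V `&` h @^-1` W).
    rewrite openE => x [Vx Wx]; apply: filterI.
      exact: open_nbhs_nbhs (conj oV Vx).
    have := smooth_continuous sh Vx.
    by apply; apply: open_nbhs_nbhs.
  exists (V `&` h @^-1` W), (prestr (V `&` h @^-1` W) (fun x => q (h x))); split.
  + by split.
  + apply: plot_comp => //.
      by move=> k; apply: kdiff_sub (sh k) => x [].
    move=> x [Vx Wx]; have := congr1 (fun g => isSome (g (h x))) E.
    rewrite prestrT //= /pdom /=; have := hV _ Vx; rewrite /pdom /=.
    by case: (q (h x)) => //= ->.
  + rewrite prestr_prestr prestr_omap setIAC setIid; apply/funext => x.
    have [[Vx Wx]|nx] := pselect ((V `&` h @^-1` W) x); last by rewrite !prestrF.
    rewrite !prestrT //=; have := congr1 (fun g => g (h x)) E.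
    by rewrite prestrT.
Defined.
End Quotient.

Section Functional.
Variables (X Y : diffSpace).

Definition smap := {f : X -> Y | smooth_map f}.

(* [fun_plot p] says that (s, x) |-> p s x is smooth on pdom p * X: a plot of
   that product is a pair of a smooth u : V -> pdom p and a plot q of X. *)
Definition eval_along m n (p : 'rV[R]_n -> option smap) (u : 'rV[R]_m -> 'rV[R]_n)
    (q : 'rV[R]_m -> option X) : 'rV[R]_m -> option Y :=
  fun w => if p (u w) is Some f then omap (sval f) (q w) else None.

Definition fun_plot n (p : 'rV[R]_n -> option smap) :=
  open (pdom p) /\
  forall m (V : set 'rV[R]_m) (u : 'rV[R]_m -> 'rV[R]_n) (q : 'rV[R]_m -> option X),
    open V -> smooth_on V u -> (forall w, V w -> pdom p (u w)) -> plot q ->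
    plot (prestr V (eval_along p u q)).

Definition fun_diff : diffSpace.
Proof.
refine (@DiffSpace smap fun_plot (fun n f => @proj1 _ _) _ _ _).
- move=> n f; split.
    by rewrite (_ : pdom _ = setT); [exact: openT|apply/funext => r; apply/propext].
  move=> m V u q oV su uV pq; apply: plot_restr => //.
  exact: (svalP f).
- move=> n f H; have of_ : open (pdom f).
    by apply: open_pdom_loc => r /H[V oV []]; exists V.
  split=> // m V u q oV su uV pq; apply: plot_loc => w; rewrite pdom_restr => -[Vw _].
  have [W [oW Ww] [_ pW]] := H _ (uV _ Vw).
  have oVW : open (V `&` u @^-1` W).
    rewrite openE => x [Vx Wx]; apply: filterI.
      exact: open_nbhs_nbhs (conj oV Vx).
    have := smooth_continuous su Vx.
    by apply; apply: open_nbhs_nbhs.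
  exists (V `&` u @^-1` W) => //.
  have := pW m (V `&` u @^-1` W) u q oVW _ _ pq.
  rewrite prestr_prestr setIAC setIid.
  rewrite (_ : prestr _ (eval_along _ _ _) = prestr (V `&` u @^-1` W) (eval_along f u q)).
    apply; first by move=> k; apply: kdiff_sub (su k) => x [].
    by move=> x [Vx Wx]; rewrite pdom_restr; split=> //; exact: uV.
  apply/funext => x.
  have [[Vx Wx]|nx] := pselect ((V `&` u @^-1` W) x); last by rewrite !prestrF.
  by rewrite !prestrT // /eval_along prestrT.
- move=> m n f V h [of_ pf] oV sh hV.
  have dE : pdom (prestr V (fun r => f (h r))) = V.
    by rewrite pdom_restr; apply/funext => r; apply/propext; split=> [[]|Vr] //; split=> //; exact: hV.
  split; first by rewrite dE.
  move=> l W u q oW su; rewrite dE => uV pq.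
  have := pf l W (fun w => h (u w)) q oW _ _ pq.
  rewrite (_ : prestr W (eval_along _ u q) = prestr W (eval_along f (fun w => h (u w)) q)).
    apply; last by move=> w Ww; apply: hV; apply: uV.
    by move=> k; apply: (kdiff_comp oW oV uV (su k) (sh k)).
  apply/funext => x; have [Wx|nx] := pselect (W x); last by rewrite !prestrF.
  by rewrite !prestrT // /eval_along prestrT //; exact: uV.
Defined.
End Functional.
End Diffeology.
Arguments diffSpace R : clear implicits.

Section Interval.
Context {R : realType}.

Definition unitI : diffSpace R := sub_diff (X := real_diff) [set t : R | 0 <= t <= 1].

Definition Ival (t : unitI) : R := sval t.

Lemma Ival_bound (t : unitI) : 0 <= Ival t <= 1. Proof. exact: (svalP t). Qed.

Lemma clamp_subproof (x : R) : 0 <= Num.max 0 (Num.min x 1) <= 1.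
Proof. by rewrite le_max lexx /= ge_max ler01 ge_min lexx orbT. Qed.

(* Only ever evaluated at points of [0, 1]. *)
Definition clamp (x : R) : unitI :=
  exist (fun t : R => 0 <= t <= 1) (Num.max 0 (Num.min x 1)) (clamp_subproof x).

Lemma clampK x : 0 <= x <= 1 -> Ival (clamp x) = x.
Proof. by move=> /andP[x0 x1]; rewrite /Ival /= min_l // max_r. Qed.

Lemma IvalK t : clamp (Ival t) = t.
Proof.
by case: t => x hx; apply: eq_exist; have := clampK hx; rewrite /Ival.
Qed.

Lemma Ival_inj : injective Ival.
Proof. by move=> s t st; rewrite -(IvalK s) st IvalK. Qed.

Definition I0 : unitI := clamp 0.
Definition I1 : unitI := clamp 1.

Lemma I0E : Ival I0 = 0. Proof. by rewrite clampK // lexx ler01. Qed.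
Lemma I1E : Ival I1 = 1. Proof. by rewrite clampK // lexx ler01. Qed.

Lemma open_preim_smooth (V W : normedModType R) (U : set V) (f : V -> W) B :
  open U -> smooth_on U f -> open B -> open (U `&` f @^-1` B).
Proof.
move=> oU sf oB; rewrite openE => x [Ux Bx]; apply: filterI.
  exact: open_nbhs_nbhs (conj oU Ux).
have := smooth_continuous sf Ux.
by apply; apply: open_nbhs_nbhs.
Qed.

Definition qval n (q : 'rV[R]_n -> option unitI) w : R :=
  if q w is Some t then Ival t else 0.

Lemma qval_smooth n (q : 'rV[R]_n -> option unitI) :
  plot q -> smooth_on (pdom q) (qval q).
Proof.
move=> [oq sq] k; have := sq k; rewrite pdom_omap in oq *.
by apply: kdiff_eq oq _ => w _; rewrite /qval /=; case: (q w).
Qed.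

Lemma unitI_plot n (V : set 'rV[R]_n) (g : 'rV[R]_n -> R) :
  open V -> smooth_on V g -> (forall w, V w -> 0 <= g w <= 1) ->
  plot (prestr V (fun w => Some (clamp (g w)))).
Proof.
move=> oV sg gV; rewrite /= /real_plot pdom_omap.
have -> : pdom (prestr V (fun w => Some (clamp (g w)))) = V.
  by rewrite pdom_restr; apply/funext => w; apply/propext; split=> [[]|].
split=> // k; apply: kdiff_eq oV _ (sg k) => w Vw /=.
by rewrite prestrT //= -[LHS](clampK (gV w Vw)).
Qed.

Lemma plot_ext (X : diffSpace R) n (f : 'rV[R]_n -> option X) :
  plot f -> forall g, f = g -> plot g.
Proof. by move=> pf g <-. Qed.

Lemma smooth_id (X : diffSpace R) : smooth_map (@idfun X).
Proof.
move=> n p pp; rewrite (_ : omap idfun \o p = p) //.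
by apply/funext => w /=; case: (p w).
Qed.

Definition id_map (X : diffSpace R) : smap X X := exist _ idfun (@smooth_id X).

Lemma smooth_comp (X Y Z : diffSpace R) (g : Y -> Z) (f : X -> Y) :
  smooth_map g -> smooth_map f -> smooth_map (g \o f).
Proof.
move=> sg sf n p /sf/sg; rewrite (_ : omap g \o _ = omap (g \o f) \o p) //.
by apply/funext => w /=; case: (p w).
Qed.

Definition comp_map (X Y Z : diffSpace R) (g : smap Y Z) (f : smap X Y) : smap X Z :=
  exist _ _ (smooth_comp (svalP g) (svalP f)).

End Interval.

Definition oval (T : Type) (o : option T) : isSome o -> T :=
  match o with
  | Some x => fun=> x
  | None => fun h => False_rect T (notF h)
  end.

Lemma ovalE (T : Type) (o : option T) (h : isSome o) : Some (oval h) = o.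
Proof. by case: o h. Qed.

Lemma oval_eq (T : Type) (o : option T) (h : isSome o) x : o = Some x -> oval h = x.
Proof. by move=> e; apply: Some_inj; rewrite ovalE. Qed.

Section Paths.
Context {R : realType}.
Implicit Types X Y E : diffSpace R.

(* Smooth paths: one-dimensional plots whose (open) domain is an interval,
   'rV[R]_1 being identified with R. *)
Record smooth_path Y := Path {
  path_fun :> R -> option Y;
  path_plot : plot (fun r : 'rV[R]_1 => path_fun (r 0 0));
  path_itv : is_interval (pdom path_fun) }.

Lemma path_eq Y (c d : smooth_path Y) : (forall t, c t = d t) -> c = d.
Proof.
case: c d => [c cp ci] [d dp di] /= /funext cd.
by case: d / cd dp di => dp di; rewrite (Prop_irrelevance cp dp) (Prop_irrelevance ci di).
Qed.

Definition phat Y := {ct : smooth_path Y * R | pdom ct.1 ct.2}.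

Definition path_connected X :=
  forall x y : X, exists (c : smooth_path X) s t, c s = Some x /\ c t = Some y.

Lemma path_map_plot X Y (f : X -> Y) (c : smooth_path X) : smooth_map f ->
  plot (fun r : 'rV[R]_1 => (omap f \o c) (r 0 0)).
Proof. by move=> sf; apply: (sf 1%N) (path_plot c). Qed.

Lemma path_map_itv X Y (f : X -> Y) (c : smooth_path X) : is_interval (pdom (omap f \o c)).
Proof. by rewrite pdom_omap; exact: path_itv. Qed.

Definition path_map X Y (f : smap X Y) (c : smooth_path X) : smooth_path Y :=
  Path (path_map_plot c (svalP f)) (@path_map_itv X Y (sval f) c).

Section Lifts.
Variables (E X : diffSpace R) (pi : E -> X) (A : phat E -> smooth_path E).

Definition horizontal (c : smooth_path E) := exists t (h : pdom c t), A (exist _ (c, t) h) = c.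

Definition lift_at (a : smooth_path X) t (xi : E) (l : smooth_path E) :=
  omap pi \o l = a /\ l t = Some xi.

(* [is_hor a t xi c] is hor_A(a, t, xi) = c: the lifts of a through xi at t
   exist, and A_t sends each of them to the A-horizontal path c. *)
Definition is_hor (a : smooth_path X) t (xi : E) (c : smooth_path E) :=
  [/\ horizontal c, exists l, lift_at a t xi l &
      forall (l : smooth_path E) (h : pdom l t), lift_at a t xi l -> A (exist _ (l, t) h) = c].
End Lifts.

Lemma seg_dom X (c : smooth_path X) r s (t : unitI) : pdom c r -> pdom c s ->
  pdom c (Ival t * s + (1 - Ival t) * r).
Proof.
move=> cr cs; have /andP[t0 t1] := Ival_bound t.
have [rs|sr] := leP r s.
- by apply: (path_itv cr cs); apply/andP; split; nra.
- by apply: (path_itv cs cr); apply/andP; split; nra.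
Qed.

Lemma seg_family_plot X (c : smooth_path X) (r : R) (phi : unitI -> unitI) m
    (V : set 'rV[R]_m) (s : 'rV[R]_m -> R) (q : 'rV[R]_m -> option unitI) :
  pdom c r -> smooth_map phi -> open V -> smooth_on V s ->
  (forall w, V w -> pdom c (s w)) -> plot q ->
  plot (prestr V (fun w => if q w is Some t
    then c (Ival (phi t) * s w + (1 - Ival (phi t)) * r) else None)).
Proof.
move=> cr sphi oV ss sV pq.
have pq' := sphi _ _ pq; set q' := omap phi \o q in pq'.
pose h (w : 'rV[R]_m) : 'rV[R]_1 :=
  (qval q' w * s w + (1 + (- 1) * qval q' w) * r) *: const_mx 1.
have oW : open (V `&` pdom q') by apply: openI => //; exact: plot_open pq'.
have := @plot_comp _ X m 1 _ (V `&` pdom q') h (path_plot c) oW.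
rewrite (_ : prestr (V `&` pdom q') _ = prestr V (fun w => if q w is Some t
    then c (Ival (phi t) * s w + (1 - Ival (phi t)) * r) else None)).
  apply.
    have sq k : kdiff k (V `&` pdom q') (qval q').
      by apply: kdiff_sub (qval_smooth pq' k) => w [].
    have ss' k : kdiff k (V `&` pdom q') s by apply: kdiff_sub (ss k) => w [].
    move=> k; apply: kdiff_scalel => //; apply: kdiffD => //; first exact: kdiffM.
    apply: kdiffM => //; last exact: kdiff_cst.
    apply: kdiffD => //; first exact: kdiff_cst.
    by apply: kdiffM => //; exact: kdiff_cst.
  move=> w [Vw]; rewrite pdom_omap /pdom /= /h /qval /q' !mxE mulr1 mulN1r /=.
  by case: (q w) => //= t _; apply: seg_dom => //; exact: sV.
rewrite (prestr_id V); rewrite [X in _ = prestr X _](_ : _ = V `&` pdom q').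
  apply/funext => w.
  have [[Vw qw]|nw] := pselect ((V `&` pdom q') w); last by rewrite !prestrF.
  rewrite !prestrT //; move: qw; rewrite pdom_omap /pdom /= /h /qval /q' !mxE mulr1 mulN1r /=.
  by case: (q w).
apply/funext => w; apply/propext; rewrite pdom_omap /pdom /=; split=> -[Vw];
  case: (q w) => //= t _; split=> //.
by apply: seg_dom => //; exact: sV.
Qed.

(* c^{r -> s} *)
Definition seg_fun X (c : smooth_path X) r s (hr : pdom c r) (hs : pdom c s) (t : unitI) : X :=
  oval (seg_dom t hr hs).

Lemma seg_smooth X (c : smooth_path X) r s (hr : pdom c r) (hs : pdom c s) :
  smooth_map (seg_fun hr hs).
Proof.
move=> n q pq.
have := @seg_family_plot X c r idfun n setT (fun=> s) q hr (@smooth_id _ _) openT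
  (fun k => kdiff_cst k _ s) (fun w _ => hs) pq.
rewrite prestr_dom // (_ : (fun w => _) = omap (seg_fun hr hs) \o q) //.
by apply/funext => w /=; case: (q w) => //= t; rewrite /seg_fun ovalE.
Qed.

Definition seg X (c : smooth_path X) r s (hr : pdom c r) (hs : pdom c s) : smap unitI X :=
  exist _ _ (seg_smooth hr hs).

End Paths.

Section PathSpace.
Context {R : realType}.
Variable X : diffSpace R.

Definition Cinf := fun_diff (@unitI R) X.
Implicit Types a b : Cinf.
Let I := @unitI R.

Definition cst_near_ends (Y : Type) (a : I -> Y) := exists2 e : R, 0 < e &
  forall t, (Ival t < e -> a t = a I0) /\ (1 - e < Ival t -> a t = a I1).

(* b \/ a: first a, then b. *)
Definition catf (b a : I -> X) : I -> X := fun t =>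
  if Ival t < 2^-1 then a (clamp (2 * Ival t)) else b (clamp (2 * Ival t - 1)).

Definition revf (a : I -> X) : I -> X := fun t => a (clamp (1 - Ival t)).

Definition reparam a b := exists f g : smap I I,
  [/\ cancel (sval f) (sval g), cancel (sval g) (sval f),
      sval f I0 = I0, sval f I1 = I1 & sval a = sval b \o sval f].

Definition Cinf_sim := quot_diff reparam.

(* b \/ a  |->  b \/ e \/ e^<- \/ a, the representatives b, e, a being constant
   near 0 and 1, as concatenation requires. *)
Definition retrace_step (x y : Cinf_sim) := exists b e a p q : Cinf,
  [/\ [/\ cst_near_ends (sval b), cst_near_ends (sval e) & cst_near_ends (sval a)],
      sval b I0 = sval a I1, sval e I1 = sval a I1,
      sval p = catf (sval b) (sval a) /\
      sval q = catf (sval b) (catf (sval e) (catf (revf (sval e)) (sval a))) &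
      x = qcls reparam p /\ y = qcls reparam q].

Definition retrace := clos_refl_sym_trans Cinf_sim retrace_step.

Definition Fspace := quot_diff retrace.

Definition Fcls a : Fspace := qcls retrace (qcls reparam a).

Lemma catf0 (b a : I -> X) : catf b a I0 = a I0.
Proof. by rewrite /catf I0E invr_gt0 ltr0n mulr0. Qed.

Lemma catf1 (b a : I -> X) : catf b a I1 = b I1.
Proof.
rewrite /catf I1E ltNge invf_le1 ?ler1n //= mulr1.
by congr (b (clamp _)); lra.
Qed.

Lemma plot_catf m (V : set 'rV[R]_m) (q : 'rV[R]_m -> option I)
    (b : 'rV[R]_m -> I -> X) (a : I -> X) e : 0 < e ->
  open V -> plot q -> smooth_map a ->
  (forall w t, V w -> Ival t < e -> b w t = a I1) ->
  (forall t, 1 - e < Ival t -> a t = a I1) ->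
  (forall q', plot q' -> plot (prestr V (fun w => omap (b w) (q' w)))) ->
  plot (prestr V (fun w => omap (catf (b w) a) (q w))).
Proof.
move=> e0 oV pq sa be ae pb.
have oq := plot_open pq; have sq := qval_smooth pq.
pose Q B := pdom q `&` qval q @^-1` B.
have oQ B : open B -> open (Q B) by move=> oB; exact: open_preim_smooth.
have kQ B k : kdiff k (Q B) (qval q) by apply: kdiff_sub (sq k) => w [].
apply: plot_loc => w0; rewrite pdom_restr => -[Vw0]; rewrite /pdom /=.
case E0 : (q w0) => [t0|//] _.
have qw0 : qval q w0 = Ival t0 by rewrite /qval E0.
have dw0 : pdom q w0 by rewrite /pdom /= E0.
have qb w t : q w = Some t -> qval q w = Ival t by rewrite /qval => ->.
have qd w : pdom q w -> exists t, q w = Some t.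
  by rewrite /pdom /=; case: (q w) => // t _; exists t.
case: (ltgtP (Ival t0) 2^-1) => ht0.
- pose B : set R := [set x | x < 2^-1].
  have oB : open B by exact: open_lt.
  exists (Q B); first by split; [exact: oQ|split=> //=; rewrite /B /= qw0].
  have H : plot (prestr (Q B) (fun w => Some (clamp (2 * qval q w)))).
    apply: unitI_plot; first exact: oQ.
      by move=> k; apply: kdiffM; [exact: oQ|exact: kdiff_cst|exact: kQ].
    move=> w [/qd[t qt]]; rewrite /B /= (qb _ _ qt).
    by have /andP[? ?] := Ival_bound t; move=> ?; apply/andP; split; lra.
  have := plot_restr (sa _ _ H) oV.
  rewrite prestr_prestr prestr_omap prestr_prestr setIC.
  move/plot_ext; apply.
  apply/funext => w; have [[Qw Vw]|nw] := pselect ((Q B `&` V) w); last by rewrite !prestrF.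
  rewrite !prestrT //=; case: Qw => /qd[t qt]; rewrite /B /= (qb _ _ qt) qt /= /catf.
  by move=> ->.
- pose B : set R := [set x | 2^-1 < x].
  have oB : open B by exact: open_gt.
  exists (Q B); first by split; [exact: oQ|split=> //=; rewrite /B /= qw0].
  have H : plot (prestr (Q B) (fun w => Some (clamp (2 * qval q w + - 1)))).
    apply: unitI_plot; first exact: oQ.
      move=> k; apply: kdiffD; [exact: oQ| |exact: kdiff_cst].
      by apply: kdiffM; [exact: oQ|exact: kdiff_cst|exact: kQ].
    move=> w [/qd[t qt]]; rewrite /B /= (qb _ _ qt).
    by have /andP[? ?] := Ival_bound t; move=> ?; apply/andP; split; lra.
  have := plot_restr (pb _ H) (oQ _ oB).
  rewrite prestr_prestr.
  move/plot_ext; apply.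
  rewrite prestr_prestr.
  apply/funext => w; have [[Qw Vw]|nw] := pselect ((Q B `&` V) w); last by rewrite !prestrF.
  rewrite !prestrT //=; case: Qw => /qd[t qt]; rewrite /B /= (qb _ _ qt) qt /= /catf.
  by move=> h; rewrite ltNge (ltW h).
- pose B : set R := [set x | 2^-1 - e / 2 < x] `&` [set x | x < 2^-1 + e / 2].
  have oB : open B by apply: openI; [exact: open_gt|exact: open_lt].
  exists (Q B).
    by split; [exact: oQ|split=> //=; split; rewrite /= qw0 ht0; lra].
  have := plot_restr (plot_cst m (a I1)) (openI (oQ _ oB) oV).
  rewrite prestr_prestr.
  move/plot_ext; apply.
  apply/funext => w; have [[Qw Vw]|nw] := pselect ((Q B `&` V) w); last by rewrite !prestrF.
  rewrite !prestrT //=; case: Qw => /qd[t qt]; rewrite /B /= (qb _ _ qt) qt /= /catf.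
  have /andP[? ?] := Ival_bound t; move=> [l1 l2]; case: ltP => ht; congr Some.
    by rewrite ae // clampK; [|apply/andP; split]; lra.
  by rewrite (be w) // clampK; [|apply/andP; split]; lra.
Qed.

Lemma catf_smooth b a : cst_near_ends (sval b) -> cst_near_ends (sval a) ->
  sval b I0 = sval a I1 -> smooth_map (catf (sval b) (sval a)).
Proof.
move=> [e e0 hb] [d d0 ha] ba n q pq.
have := @plot_catf n setT q (fun=> sval b) (sval a) (Num.min e d).
rewrite prestr_dom //; apply=> //.
- by rewrite lt_min e0.
- exact: openT.
- exact: (svalP a).
- by move=> _ t _; rewrite lt_min => /andP[/(hb t).1 -> _].
- move=> t h; apply: (ha t).2; apply: le_lt_trans h.
  by rewrite lerD2l lerN2 ge_min lexx orbT.
- by move=> q' pq'; rewrite prestr_dom //; exact: (svalP b).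
Qed.

Definition cat b a (hb : cst_near_ends (sval b)) (ha : cst_near_ends (sval a))
  (hba : sval b I0 = sval a I1) : Cinf := exist _ _ (catf_smooth hb ha hba).

Lemma catf_ends (b a : I -> X) :
  cst_near_ends b -> cst_near_ends a -> cst_near_ends (catf b a).
Proof.
move=> [e e0 hb] [d d0 ha]; exists (Num.min (Num.min e d / 2) 2^-1).
  by rewrite lt_min divr_gt0 ?lt_min ?e0 ?d0 // invr_gt0 ltr0n.
move=> t; have /andP[t0 t1] := Ival_bound t.
rewrite catf0 catf1; split=> h.
  move: h; rewrite lt_min => /andP[h1 h2]; rewrite /catf h2.
  apply: (ha _).1; rewrite clampK; last by apply/andP; split; lra.
  by have : Num.min e d <= d by [rewrite ge_min lexx orbT]; lra.
have h1 : 1 - 2^-1 < Ival t.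
  by apply: le_lt_trans h; rewrite lerD2l lerN2 ge_min lexx orbT.
have h2 : 1 - Num.min e d / 2 < Ival t.
  by apply: le_lt_trans h; rewrite lerD2l lerN2 ge_min lexx.
rewrite /catf ltNge (_ : 2^-1 <= Ival t) /=; last lra.
apply: (hb _).2; rewrite clampK; last by apply/andP; split; lra.
by have : Num.min e d <= e by [rewrite ge_min lexx]; lra.
Qed.

Lemma qclsP (Y : diffSpace R) (r : Y -> Y -> Prop) x y :
  (forall z, r z z) -> qcls r x = qcls r y -> r x y.
Proof.
by move=> rr /(congr1 sval) /= E; rewrite E.
Qed.

Lemma reparam_refl a : reparam a a.
Proof. by exists (id_map _), (id_map _). Qed.

Lemma reparam_end a b : reparam a b -> sval a I1 = sval b I1.
Proof. by move=> [f [g [_ _ _ f1 ->]]] /=; rewrite f1. Qed.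

Lemma retrace_end x y : retrace x y ->
  forall a b, x = qcls reparam a -> y = qcls reparam b -> sval a I1 = sval b I1.
Proof.
elim=> [{}x {}y [b [e [a [p [q [_ _ _ [Ep Eq] [-> ->]]]]]]]|{}x|{}x {}y _ IH|{}x {}y z _ IH1 _ IH2].
- move=> a' b' /(qclsP reparam_refl)/reparam_end <- /(qclsP reparam_refl)/reparam_end <-.
  by rewrite Ep Eq !catf1.
- by move=> a b -> /(qclsP reparam_refl)/reparam_end.
- by move=> a b ya xb; rewrite (IH b a).
- move=> a b xa zb; have [c yc] := qcls_surj y.
  by rewrite (IH1 a c) // (IH2 c b).
Qed.

Lemma retrace_refl x : retrace x x. Proof. exact: rst_refl. Qed.

Lemma Fcls_end a b : Fcls a = Fcls b -> sval a I1 = sval b I1.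
Proof.
move=> /(qclsP retrace_refl) h; exact: retrace_end h _ _ erefl erefl.
Qed.

Variable x0 : X.

(* Classes in F(X) are taken with representatives constant near 0 and 1. *)
Definition based a := cst_near_ends (sval a) /\ sval a I0 = x0.

Definition pointedF := sub_diff (X := Fspace) [set xi | exists2 a, based a & xi = Fcls a].

Definition class_of_based a (h : based a) : pointedF := exist _ _ (ex_intro2 _ _ a h erefl).

Definition rep (xi : pointedF) : Cinf := s2val (cid2 (svalP xi)).

Lemma rep_based xi : based (rep xi).
Proof. exact: (s2valP (cid2 (svalP xi))). Qed.

Lemma repK xi : class_of_based (rep_based xi) = xi.
Proof.
have : sval (class_of_based (rep_based xi)) = sval xi by exact: (esym (s2valP' (cid2 (svalP xi)))).
by move: (class_of_based _) => [u hu]; case: xi => v hv /= uv; exact: eq_exist.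
Qed.

Definition tau (xi : pointedF) : X := sval (rep xi) I1.

Lemma tau_class a (h : based a) : tau (class_of_based h) = sval a I1.
Proof.
apply: Fcls_end; have := congr1 sval (repK (class_of_based h)); exact.
Qed.

Lemma tau_smooth : smooth_map tau.
Proof.
move=> n p pp; apply: plot_loc => s; rewrite pdom_omap => ps.
have := pp s; rewrite pdom_omap => /(_ ps)[V [q [[oV Vs] pq E]]].
have qs : pdom q s.
  have := congr1 (fun g => isSome (g s)) E.
  by rewrite prestrT // /pdom /=; move: ps; rewrite /pdom /=; case: (p s) => //= ? _; case: (q s).
have [W [q2 [[oW Ws] [oq2 pq2] E2]]] := pq s qs.
exists (V `&` W); first by split; [exact: openI|].
have := pq2 n (V `&` W `&` pdom q2) idfun (fun=> Some I1) (openI (openI oV oW) oq2)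
  (fun k => kdiff_id k _) (fun w => @proj2 _ _) (plot_cst _ _).
move/plot_ext; apply.
have dE w : (V `&` W) w -> forall xi, p w = Some xi ->
    exists2 a, q2 w = Some a & tau xi = sval a I1.
  move=> [Vw Ww] xi pw; have := congr1 (fun g => g w) E; rewrite prestrT //= pw /=.
  have := congr1 (fun g => g w) E2; rewrite prestrT //=.
  case: (q2 w) => [a|] /= -> //= [] Exi; exists a => //.
  by apply: Fcls_end; rewrite /Fcls -[RHS]Exi -{2}(repK xi).
have dN w : (V `&` W) w -> p w = None -> q2 w = None.
  move=> [Vw Ww] pw; have := congr1 (fun g => g w) E; rewrite prestrT //= pw /=.
  by have := congr1 (fun g => g w) E2; rewrite prestrT //=; case: (q2 w) => [a|] /= ->.
apply/funext => w; have [VWw|nw] := pselect ((V `&` W) w); last first.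
  by rewrite !prestrF // => -[].
rewrite (prestrT _ VWw) /=; case pw : (p w) => [xi|] /=.
  have [a qa ->] := dE w VWw xi pw.
  by rewrite prestrT /eval_along /= ?qa //; split=> //; rewrite /pdom /= qa.
by rewrite prestrF // => -[_]; rewrite /pdom /= (dN w).
Qed.

Definition tau_map : smap pointedF X := exist _ _ tau_smooth.

(* A path c^{r -> s} is in general not constant near 0 and 1, and no
   diffeomorphism of [0, 1] makes it so. Before being concatenated it is
   precomposed with a smooth phi : [0, 1] -> [0, 1] equal to 0 near 0 and to 1
   near 1. For a path that is already constant near 0 and 1, precomposition with
   a phi of positive derivative between its plateaus does not change the class
   modulo [reparam]. *)
Definition flattening := {phi : smap I I |
  [/\ cst_near_ends (sval phi), sval phi I0 = I0 & sval phi I1 = I1]}.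

Section Transport.
Variables (phi : flattening) (c : smooth_path X) (r : R) (b : Cinf) (hb : based b)
  (hr : c r = Some (sval b I1)).

Let cr : pdom c r. Proof. by rewrite /pdom /= hr. Qed.

Definition flat_seg s (hs : pdom c s) : Cinf := comp_map (seg cr hs) (sval phi).

Lemma flat_seg_ends s (hs : pdom c s) : cst_near_ends (sval (flat_seg hs)).
Proof.
have [[e e0 h] _ _] := svalP phi; exists e => // t.
by split=> [/(h t).1|/(h t).2] /= ->.
Qed.

Lemma flat_seg0 s (hs : pdom c s) : sval (flat_seg hs) I0 = sval b I1.
Proof.
have [_ p0 _] := svalP phi; rewrite /= p0; apply: oval_eq.
by rewrite I0E mul0r add0r subr0 mul1r.
Qed.

Definition flat_concat s (hs : pdom c s) : Cinf :=
  cat (flat_seg_ends hs) hb.1 (flat_seg0 hs).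

Lemma flat_concat_based s (hs : pdom c s) : based (flat_concat hs).
Proof.
split; first by apply: catf_ends; [exact: flat_seg_ends|exact: hb.1].
by rewrite /= catf0; exact: hb.2.
Qed.

Definition transport_fun (s : R) : option pointedF :=
  match pselect (pdom c s) with
  | left hs => Some (class_of_based (flat_concat_based hs))
  | right _ => None
  end.

Lemma transport_fun_dom : pdom transport_fun = pdom c.
Proof.
by apply/funext => s; apply/propext; rewrite {1}/pdom /= /transport_fun; case: pselect.
Qed.

Lemma transport_fun_itv : is_interval (pdom transport_fun).
Proof. by rewrite transport_fun_dom; exact: path_itv. Qed.

Lemma transport_fun_plot : plot (fun s : 'rV[R]_1 => transport_fun (s 0 0)).
Proof.
pose q (s : 'rV[R]_1) : option Cinf :=
  if pselect (pdom c (s 0 0)) is left hs then Some (flat_concat hs) else None.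
have dq : pdom q = pdom (fun s : 'rV[R]_1 => c (s 0 0)).
  by apply/funext => s; apply/propext; rewrite {1}/pdom /= /q; case: pselect.
have oq : open (pdom q) by rewrite dq; exact: plot_open (path_plot c).
have pq : plot q.
  split=> // m V u p oV su uV pp.
  have sphi := svalP (sval phi).
  have [[e e0 he] phi0 _] := svalP phi; have [[d d0 hd] _] := hb.
  pose B w (t : I) : X :=
    if pselect (pdom c (u w 0 0)) is left hs then sval (flat_seg hs) t else x0.
  have H : plot (prestr V (fun w => omap (catf (B w) (sval b)) (p w))).
    apply: (@plot_catf m V p B (sval b) (Num.min e d)) => //.
    - by rewrite lt_min e0.
    - exact: (svalP b).
    - move=> w t Vw; rewrite lt_min => /andP[te _]; rewrite /B.
      have : pdom c (u w 0 0) by have := uV w Vw; rewrite dq.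
      case: pselect => // hs _; rewrite -(flat_seg0 hs).
      by rewrite /= (he t).1.
    - move=> t h; apply: (hd t).2; apply: le_lt_trans h.
      by rewrite lerD2l lerN2 ge_min lexx orbT.
    - move=> q' pq'.
      have cV w : V w -> pdom c (u w 0 0) by move=> /uV; rewrite dq.
      have := seg_family_plot cr sphi oV (fun k => kdiff_coord 0 0 oV (su k)) cV pq'.
      move/plot_ext; apply.
      apply/funext => w; have [Vw|nw] := pselect (V w); last by rewrite !prestrF.
      rewrite !prestrT //; case: (q' w) => //= t; rewrite /B.
      have := cV w Vw; case: pselect => // hs _.
      by rewrite /= /seg_fun ovalE.
  apply: (plot_ext H).
  apply/funext => w; have [Vw|nw] := pselect (V w); last by rewrite !prestrF.
  rewrite !prestrT // /eval_along /q /B; have := uV w Vw; rewrite dq /pdom /=.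
  by case: pselect.
move=> /= s hs.
have pq1 : plot (omap (qcls reparam) \o q : _ -> option Cinf_sim).
  move=> s' hs'; exists setT, q; split=> //; first by split=> //; exact: openT.
  by rewrite prestr_dom.
exists setT, (omap (qcls reparam) \o q); split=> //; first by split=> //; exact: openT.
rewrite prestr_dom //; apply/funext => s'; rewrite /= /transport_fun /q.
by case: pselect.
Qed.

(* s |-> [c^{r -> s} \/ b] *)
Definition transport : smooth_path pointedF := Path transport_fun_plot (@transport_fun_itv).

End Transport.

Definition theta_start (ar : phat pointedF) : pointedF := oval (svalP ar).

Lemma theta_end (ar : phat pointedF) :
  path_map tau_map (sval ar).1 (sval ar).2 = Some (sval (rep (theta_start ar)) I1).
Proof. by rewrite /= -[(sval ar).1 _]/(((sval ar).1) (sval ar).2) -(ovalE (svalP ar)). Qed.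

Definition Theta (phi : flattening) (ar : phat pointedF) : smooth_path pointedF :=
  transport phi (rep_based (theta_start ar)) (theta_end ar).

Definition alpha_bar (phi : flattening) (alpha : smooth_path X) (t0 : R)
    (beta0 : Cinf) (hb : based beta0)
    (h : alpha t0 = Some (tau (class_of_based hb))) : smooth_path pointedF :=
  transport phi hb (etrans h (congr1 Some (tau_class hb))).

End PathSpace.

Arguments flattening R : clear implicits.
Arguments cst_near_ends {R Y} a.
Arguments tau {R X x0} xi.
Arguments Theta {R X x0} phi ar.

(* Main.v *)
(** Theta_r of a lift of alpha through [beta0] only differs from alpha_bar in the
    representative of the class [beta0] that is prolonged along alpha, so the point
    is that b |-> [c \/ b] is well defined on retrace classes and that
    [cst \/ b] = [b]; the latter makes alpha_bar itself a lift, hence horizontal.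
    Both reduce to three changes of parameter: c \/ a ~ c \/ a' if a ~ a',
    (c \/ b) \/ a ~ c \/ (b \/ a), and b ~ cst \/ b. The obvious ones are only
    piecewise smooth. As all the paths are constant near their end points, the
    breaks can be smoothed by blending increasing functions with a smooth step,
    which produces a smooth F : R -> R of positive derivative fixing 0 and 1. *)

Require Import Defs.
From mathcomp Require Import all_boot all_order all_algebra.
From mathcomp Require Import boolp classical_sets reals.
From mathcomp Require Import functions topology normedtype derive.
From mathcomp Require Import sequences realfun exp ring lra.
From Stdlib Require Import Relation_Operators.

Import Order.TTheory GRing.Theory Num.Theory numFieldNormedType.Exports.

Set Implicit Arguments.
Unset Strict Implicit.
Unset Printing Implicit Defensive.

Local Open Scope ring_scope.
Local Open Scope classical_set_scope.

(** * Smooth functions *)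

Lemma open_itvoo (R : realType) (a b : R) : open [set x : R | a < x < b].
Proof. by rewrite -set_itvoo; exact: itv_open. Qed.

#[local] Hint Extern 0 (open _) =>
  solve [exact: openT | exact: open_lt | exact: open_gt | exact: open_itvoo] : core.

Section SmoothFunctions.
Context {R : realType}.

Lemma kdiffV (V : normedModType R) k (U : set V) (f : V -> R) : open U ->
  (forall x, U x -> f x != 0) -> kdiff k U f -> kdiff k U (fun x => (f x)^-1).
Proof.
move=> oU f0; elim: k => // k IHk kf; have [df ddf] := kf.
have kVf := IHk (kdiffS kf).
split=> [x Ux|v]; first exact: differentiableV (df _ Ux) (f0 _ Ux).
apply: kdiff_eq oU _ (kdiffM oU (@kdiff_cst R V R k U (-1))
  (kdiffM oU (kdiffM oU kVf kVf) (ddf v))) => x Ux.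
rewrite [RHS](_ : _ = - f x ^- 2 * 'd f x v); last first.
  exact: (congr1 (@^~ v) (diffV (df _ Ux) (f0 _ Ux))).
by rewrite mulN1r mulNr -exprVn expr2.
Qed.

Lemma kdiff_affine (V : normedModType R) k (U : set V) (f : V -> R) (a b : R) :
  open U -> kdiff k U f -> kdiff k U (fun x => a * f x + b).
Proof.
move=> oU kf; apply: kdiffD => //; last exact: kdiff_cst.
by apply: kdiffM => //; exact: kdiff_cst.
Qed.

Lemma kdiffB (V : normedModType R) k (U : set V) (f g : V -> R) : open U ->
  kdiff k U f -> kdiff k U g -> kdiff k U (fun x => f x - g x).
Proof.
move=> oU kf kg; apply: kdiffD => //.
by apply: kdiff_eq oU _ (kdiff_affine (-1) 0 oU kg) => x _; rewrite addr0 mulN1r.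
Qed.

Lemma is_derive1E (f : R -> R) (x l : R) : is_derive x 1 f l -> f^`() x = l.
Proof. by move=> df; rewrite derive1E derive_val. Qed.

Lemma kdiffS_derive1 k (U : set R) (f : R -> R) : open U ->
  kdiff k.+1 U f <-> (forall x, U x -> derivable f x 1) /\ kdiff k U f^`().
Proof.
move=> oU; split=> -[df ddf]; split.
- by move=> x /df/derivable1_diffP.
- by apply: kdiff_eq oU _ (ddf 1) => x /df dfx; rewrite derive1E'.
- by move=> x /df/derivable1_diffP.
- move=> v; apply: kdiff_eq oU _ (kdiffM oU (@kdiff_cst R R R k U v) ddf).
  by move=> x /df/derivable1_diffP dfx; rewrite diff1E.
Qed.

Lemma smooth_on_is_derive (U : set R) (f : R -> R) x :
  smooth_on U f -> U x -> is_derive x 1 f (f^`() x).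
Proof.
move=> /(_ 1%N)[df _] /df/derivable1_diffP dfx.
by apply: DeriveDef => //; rewrite derive1E.
Qed.

Lemma kdiff_comp1 (V : normedModType R) k (U : set V) (U' : set R)
    (f : V -> R) (g : R -> R) : open U -> open U' ->
  (forall x, U x -> U' (f x)) ->
  kdiff k U f -> kdiff k U' g -> kdiff k U (fun x => g (f x)).
Proof.
move=> oU oU' fU; elim: k f g fU => // k IHk f g fU kf kg.
have [df ddf] := kf; have [dg _] := kg; have [_ ddg] := (kdiffS_derive1 k g oU').1 kg.
split=> [x Ux|v]; first exact: differentiable_comp (df _ Ux) (dg _ (fU _ Ux)).
apply: kdiff_eq oU _ (kdiffM oU (ddf v) (IHk _ _ fU (kdiffS kf) ddg)) => x Ux.
rewrite [RHS](_ : _ = 'd g (f x) ('d f x v)); last first.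
  exact: (congr1 (@^~ v) (diff_comp (df _ Ux) (dg _ (fU _ Ux)))).
by rewrite diff1E //; exact: dg (fU _ Ux).
Qed.

Lemma nondecreasing_derive1_ge0 (f : R -> R) (x : R) :
  (forall y : R, derivable f y 1) -> {homo f : y z / y <= z} -> 0 <= f^`() x.
Proof.
(* [incr_derive1_ge0] asks for a strictly increasing function. *)
move=> df ndf; apply/ler_addgt0Pr => /= e e0.
have dfe (y : R) : is_derive y 1 (f + e *: id : R -> R) (f^`()%classic y + e *: 1).
  by apply: is_deriveD; apply: DeriveDef => //; rewrite derive1E.
have := @incr_derive1_ge0 R (f + e *: id : R -> R) setT x.
rewrite (is_derive1E (dfe x)) [e *: 1]mulr1; apply.
- by move=> y _; have [] := dfe y.
- move=> y z _ _ yz; apply: ler_ltD; first exact: ndf (ltW yz).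
  by rewrite /GRing.scale /= ltr_pM2l.
- by rewrite interiorT.
Qed.

Lemma is_derive_sqr_bound (f : R -> R) (a C : R) :
  (forall x, `|f x - f a| <= C * (x - a) ^+ 2) -> is_derive a 1 f 0.
Proof.
move=> fC; have C'0 : 0 < `|C| + 1 by rewrite ltr_wpDl.
suff : h^-1 *: ((f \o shift a) (h *: 1) - f a) @[h --> (0 : R)^'] --> (0 : R).
  by move=> dfa; apply: DeriveDef; [apply/cvg_ex; exists 0|exact/cvg_lim].
apply/cvgrPdist_le => /= e e0; near=> h.
have h0 : h != 0 by near: h; exact: nbhs_dnbhs_neq.
have he : `|h| < e / (`|C| + 1) by near: h; apply: dnbhs0_lt; rewrite divr_gt0.
rewrite sub0r normrN [h *: 1]mulr1 normrM normfV mulrC ler_pdivrMr ?normr_gt0 //.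
apply: (le_trans (fC _)); rewrite addrK -real_normK ?num_real // expr2 mulrA.
apply: ler_wpM2r => //; rewrite ltr_pdivlMr // in he; rewrite mulrC.
apply: le_trans (ltW he); apply: ler_wpM2l => //.
by apply: le_trans (ler_norm _) _; rewrite lerDl.
Unshelve. all: by end_near.
Qed.

End SmoothFunctions.

(** * A smooth step function *)

Section SmoothStep.
Context {R : realType}.
Implicit Types (n : nat) (x y : R).

(* The factors x^-n make the family stable under differentiation. *)
Definition flat_exp n x : R := if 0 < x then x^-1 ^+ n * expR (- x^-1) else 0.

Lemma flat_exp_le0 n x : x <= 0 -> flat_exp n x = 0.
Proof. by rewrite /flat_exp leNgt => /negbTE ->. Qed.

Lemma flat_exp_gt0 n x : 0 < x -> 0 < flat_exp n x.
Proof.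
by move=> x0; rewrite /flat_exp x0 mulr_gt0 ?expR_gt0 // exprn_gt0 // invr_gt0.
Qed.

Lemma flat_exp_ge0 n x : 0 <= flat_exp n x.
Proof. by have [/flat_exp_le0->|/flat_exp_gt0/ltW->] := leP x 0. Qed.

Lemma flat_exp_nondecreasing : {homo flat_exp 0 : x y / x <= y}.
Proof.
move=> x y xy; have [x0|x0] := leP x 0; first by rewrite flat_exp_le0 // flat_exp_ge0.
have y0 := lt_le_trans x0 xy; rewrite /flat_exp x0 y0 !expr0 !mul1r.
by rewrite ler_expR lerN2 lef_pV2.
Qed.

Lemma flat_exp_le_sqr n x : flat_exp n x <= (n.+2)`!%:R * x ^+ 2.
Proof.
have [x0|x0] := leP x 0; first by rewrite flat_exp_le0 // mulr_ge0 // sqr_ge0.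
have fact0 : 0 < n.+2`!%:R :> R by rewrite ltr0n fact_gt0.
have expR_ge : x^-1 ^+ n.+2 <= n.+2`!%:R * expR x^-1.
  rewrite mulrC -ler_pdivrMr //; apply: le_trans (expR_ge1Dxn n.+1 _).
    by rewrite lerDr.
  by rewrite invr_ge0 ltW.
rewrite /flat_exp x0 expRN ler_pdivrMr ?expR_gt0 // mulrAC.
rewrite (_ : x^-1 ^+ n = x^-1 ^+ n.+2 * x ^+ 2) ?ler_wpM2r ?sqr_ge0 //.
by rewrite -addn2 exprD -mulrA -exprMn mulVf ?gt_eqF // expr1n mulr1.
Qed.

Lemma is_derive_flat_exp n x :
  is_derive x 1 (flat_exp n) (flat_exp n.+2 x - n%:R * flat_exp n.+1 x).
Proof.
have [x0|x0|->] := ltgtP x 0.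
- rewrite !flat_exp_le0 ?(ltW x0) // mulr0 subr0.
  apply: (@near_eq_is_derive _ _ _ (cst 0)).
  by near=> z; rewrite flat_exp_le0 //; apply: ltW; near: z; exact: lt_nbhsl.
- have dinv := is_deriveV (lt0r_neq0 x0) (is_derive_id x 1).
  have dM := is_deriveM (is_deriveX n dinv)
    (is_derive1_comp (is_derive_expR _) (is_deriveN dinv)).
  apply: (near_eq_is_derive _ (is_derive_eq dM _)).
    have : \forall z \near x, 0 < z by exact: lt_nbhsr.
    by apply: filterS => z z0; rewrite /flat_exp z0 !fctE.
  rewrite /flat_exp x0 !fctE /= /GRing.scale /= -exprVn.
  by case: n {dM} => [|n]; rewrite ?mul0r !exprS ?expr0; ring.
- rewrite !flat_exp_le0 // mulr0 subr0.
  apply: (@is_derive_sqr_bound _ _ _ (n.+2)`!%:R) => y.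
  by rewrite (flat_exp_le0 n (lexx 0)) !subr0 ger0_norm ?flat_exp_ge0 // flat_exp_le_sqr.
Unshelve. all: by end_near.
Qed.

Lemma flat_exp_smooth n : smooth_on setT (flat_exp n).
Proof.
move=> k; elim: k n => // k IHk n; apply/kdiffS_derive1 => //.
split=> [x _|]; first by have [] := is_derive_flat_exp n x.
have := kdiffB openT (IHk n.+2)
  (kdiffM openT (@kdiff_cst R R R k setT n%:R) (IHk n.+1)).
by apply: kdiff_eq openT _ => x _; rewrite (is_derive1E (is_derive_flat_exp n x)).
Qed.

Definition step01 x : R := flat_exp 0 x / (flat_exp 0 x + flat_exp 0 (1 - x)).

Lemma step01_den_gt0 x : 0 < flat_exp 0 x + flat_exp 0 (1 - x).
Proof.
have [x0|x0] := leP x 0.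
  by rewrite ltr_wpDl ?flat_exp_ge0 // flat_exp_gt0 //; lra.
by rewrite ltr_pwDl ?flat_exp_ge0 // flat_exp_gt0.
Qed.

Lemma step01_le0 x : x <= 0 -> step01 x = 0.
Proof. by move=> x0; rewrite /step01 flat_exp_le0 // mul0r. Qed.

Lemma step01_ge1 x : 1 <= x -> step01 x = 1.
Proof.
move=> x1; have := step01_den_gt0 x; rewrite /step01 [flat_exp 0 (1 - x)]flat_exp_le0.
  by rewrite addr0 => /lt0r_neq0; exact: divff.
by rewrite subr_le0.
Qed.

Lemma step01_bound x : 0 <= step01 x <= 1.
Proof.
rewrite divr_ge0 ?flat_exp_ge0 ?(ltW (step01_den_gt0 _)) //=.
by rewrite ler_pdivrMr ?step01_den_gt0 // mul1r lerDl flat_exp_ge0.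
Qed.

Lemma step01_nondecreasing : {homo step01 : x y / x <= y}.
Proof.
move=> x y xy; rewrite ler_pdivrMr ?step01_den_gt0 // mulrAC.
rewrite ler_pdivlMr ?step01_den_gt0 // !mulrDr [flat_exp 0 y * flat_exp 0 x]mulrC lerD2l.
by rewrite ler_pM ?flat_exp_ge0 ?flat_exp_nondecreasing //; lra.
Qed.

Lemma step01_smooth : smooth_on setT step01.
Proof.
move=> k; have kflip : kdiff k setT (fun x : R => flat_exp 0 (1 - x)).
  apply: (@kdiff_comp1 _ _ _ _ setT (fun x => 1 - x)) => //; last exact: flat_exp_smooth.
  by apply: kdiffB => //; [exact: kdiff_cst|exact: kdiff_id].
apply: kdiffM => //; first exact: flat_exp_smooth.
apply: kdiffV => // [x _|]; first by rewrite lt0r_neq0 // step01_den_gt0.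
by apply: kdiffD => //; exact: flat_exp_smooth.
Qed.

Lemma smooth_step_exists (u v : R) : u < v -> exists chi : R -> R,
  [/\ smooth_on setT chi, forall x, 0 <= chi x <= 1, forall x, 0 <= chi^`() x,
      forall x, x <= u -> chi x = 0 & forall x, v <= x -> chi x = 1].
Proof.
rewrite -subr_gt0 => vu0; pose rescale x := (v - u)^-1 * x + - (u / (v - u)).
have rescaleE x : rescale x = (x - u) / (v - u) by rewrite /rescale; ring.
have chi_smooth : smooth_on setT (fun x => step01 (rescale x)).
  move=> k; apply: (@kdiff_comp1 _ _ _ _ setT) => //; last exact: step01_smooth.
  by apply: (@kdiff_affine _ _ _ _ idfun) => //; exact: kdiff_id.
exists (fun x => step01 (rescale x)); split=> // x.
- exact: step01_bound.
- apply: nondecreasing_derive1_ge0 => y.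
    by case: (smooth_on_is_derive (x := y) chi_smooth I).
  by move=> z yz; apply: step01_nondecreasing; rewrite lerD2r ler_pM2l ?invr_gt0.
- by move=> xu; rewrite rescaleE step01_le0 // pmulr_lle0 ?invr_gt0 // subr_le0.
- by move=> vx; rewrite rescaleE step01_ge1 // ler_pdivlMr //; lra.
Qed.

End SmoothStep.

(** * Smooth increasing functions *)

Section SmoothIncr.
Context {R : realType}.

Definition smooth_incr (U : set R) (f : R -> R) :=
  smooth_on U f /\ forall x, U x -> 0 < f^`() x.

Lemma smooth_incr_eq (U : set R) (f g : R -> R) : open U ->
  (forall x, U x -> f x = g x) -> smooth_incr U f -> smooth_incr U g.
Proof.
move=> oU fg [sf pf]; split=> [k|x Ux]; first exact: kdiff_eq oU fg (sf k).
have fgx : \forall y \near x, f y = g y.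
  by apply: filterS fg _; exact: open_nbhs_nbhs (conj oU Ux).
by rewrite (is_derive1E (near_eq_is_derive fgx (smooth_on_is_derive sf Ux))) pf.
Qed.

Lemma smooth_incr_sub (U U' : set R) (f : R -> R) :
  U' `<=` U -> smooth_incr U f -> smooth_incr U' f.
Proof.
move=> UU' [sf pf]; split=> [k|x /UU']; last exact: pf.
exact: kdiff_sub UU' (sf k).
Qed.

Lemma smooth_incr_loc (U : set R) (f : R -> R) :
  (forall x, U x -> exists2 A, open_nbhs x A & smooth_incr (A `&` U) f) ->
  smooth_incr U f.
Proof.
move=> locf; split=> [k|x Ux].
  by apply: kdiff_loc => x /locf[A oA [sA _]]; exists A.
by have [A [_ Ax] [_ ->]] := locf x Ux.
Qed.

Lemma smooth_incr_affine (U : set R) (f : R -> R) (a b : R) :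
  (forall x, f x = a * x + b) -> 0 < a -> smooth_incr U f.
Proof.
move=> /funext-> a0; apply: smooth_incr_sub (@subsetT _ U) _; split=> [k|x _].
  by apply: (@kdiff_affine _ _ _ _ idfun) => //; exact: kdiff_id.
have : is_derive x 1 (a *: id + cst b : R -> R) (a *: 1 + 0) by exact: is_deriveD.
by move=> /is_derive1E ->; rewrite [a *: 1]mulr1 addr0.
Qed.

Lemma smooth_incr_dilate (U : set R) (a : R) : 0 < a -> smooth_incr U ( *%R a).
Proof. by apply: (@smooth_incr_affine U _ a 0) => x; rewrite addr0. Qed.

Lemma smooth_incr_id (U : set R) : smooth_incr U id.
Proof. by apply: (@smooth_incr_affine U _ 1 0) => // x; rewrite mul1r addr0. Qed.

Lemma smooth_incr_comp (U U' : set R) (f g : R -> R) : open U -> open U' ->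
  (forall x, U x -> U' (f x)) -> smooth_incr U f -> smooth_incr U' g ->
  smooth_incr U (fun x => g (f x)).
Proof.
move=> oU oU' UU' [sf pf] [sg pg]; split=> [k|x Ux].
  exact: kdiff_comp1 oU oU' UU' (sf k) (sg k).
have dgf := is_derive1_comp (smooth_on_is_derive sg (UU' _ Ux)) (smooth_on_is_derive sf Ux).
by rewrite (is_derive1E dgf) mulr_gt0 ?pf ?pg //; exact: UU'.
Qed.

Lemma smooth_incr_continuous (U : set R) (f : R -> R) x :
  smooth_incr U f -> U x -> {for x, continuous f}.
Proof. by move=> [sf _]; exact: smooth_continuous. Qed.

Lemma smooth_incr_lt (U : set R) (f : R -> R) x y : smooth_incr U f ->
  [set z | x <= z <= y] `<=` U -> x < y -> f x < f y.
Proof.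
move=> gf xyU xy.
have Uz z : z \in `[x, y]%R -> U z by rewrite in_itv /= => xzy; exact: xyU.
have Uz' z : z \in `]x, y[%R -> U z by move=> /subset_itv_oo_cc; exact: Uz.
apply: (@gtr0_derive1_incr R f x y) => //.
- by move=> z /Uz' zU; case: (smooth_on_is_derive gf.1 zU).
- by move=> z /Uz'; exact: gf.2.
- by apply: continuous_in_subspaceT => z /set_mem/Uz; exact: smooth_incr_continuous.
Qed.

Lemma smooth_incr_le (U : set R) (f : R -> R) x y : smooth_incr U f ->
  [set z | x <= z <= y] `<=` U -> x <= y -> f x <= f y.
Proof.
move=> gf xyU; rewrite le_eqVlt => /predU1P[->//|xy].
by apply: ltW; exact: smooth_incr_lt xyU xy.
Qed.

Lemma smooth_incr_mono (f : R -> R) : smooth_incr setT f -> {mono f : x y / x <= y}.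
Proof. by move=> gf; apply: le_mono => x y; exact: smooth_incr_lt gf (@subsetT _ _). Qed.

Lemma smooth_incr_IVT (f : R -> R) (x y z : R) : smooth_incr setT f -> x <= y ->
  f x <= z <= f y -> exists2 c, x <= c <= y & f c = z.
Proof.
move=> gf xy fxzy; have fxy : f x <= f y by rewrite (smooth_incr_mono gf).
have [||c cxy <-] := @IVT R f x y z xy; last by exists c.
- by apply: continuous_subspaceT => t; exact: smooth_incr_continuous gf _.
- by rewrite min_l // max_r.
Qed.

Lemma smooth_incr_open_range (f : R -> R) : smooth_incr setT f -> open (range f).
Proof.
move=> gf; have flt := leW_mono (smooth_incr_mono gf).
rewrite openE => _ [x _ <-].
apply: (@filterS _ _ _ [set z | f (x - 1) < z < f (x + 1)]) => [z /andP[fz zf]|].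
  have [||c _ <-] := @smooth_incr_IVT f (x - 1) (x + 1) z gf; [lra| |by exists c].
  by rewrite !ltW.
by apply: open_nbhs_nbhs; split=> //=; rewrite !flt; lra.
Qed.

Lemma smooth_incr_inverse (f : R -> R) : smooth_incr setT f ->
  exists2 g : R -> R, cancel f g & smooth_on (range f) g.
Proof.
move=> gf; have [sf pf] := gf; have open_range := smooth_incr_open_range gf.
pose g y := xget 0 [set x | f x = y].
have fK : cancel f g.
  move=> x; apply: (inc_inj (smooth_incr_mono gf)).
  exact: (@xgetPex _ 0 [set z | f z = f x]) (ex_intro _ x erefl).
exists g => //.
have dg x : is_derive (f x) 1 g (f^`()%classic x)^-1.
  apply: (@is_derive_inverse R f g).
  - by near=> z; exact: fK.
  - by near=> z; exact: smooth_incr_continuous gf _.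
  - exact: smooth_on_is_derive sf _.
  - by rewrite gt_eqF // pf.
elim=> // k IHk; apply/kdiffS_derive1 => //; split=> [_ [x _ <-]|].
  by have [] := dg x.
have kg : kdiff k (range f) (fun y => (f^`()%classic (g y))^-1).
  apply: kdiffV => // [y _|]; first by rewrite gt_eqF // pf.
  apply: (@kdiff_comp1 _ _ _ _ setT g) => //.
  by have [] := (kdiffS_derive1 k f openT).1 (sf k.+1).
by apply: kdiff_eq kg => // _ [x _ <-]; rewrite fK (is_derive1E (dg x)).
Unshelve. all: by end_near.
Qed.

(* The derivative of f1 + chi (f2 - f1) is a convex combination of those of f1
   and f2 plus the nonnegative term chi' (f2 - f1). *)
Lemma smooth_incr_convex (U : set R) (chi f1 f2 : R -> R) : open U ->
  smooth_on U chi -> (forall x, U x -> 0 <= chi x <= 1) ->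
  (forall x, U x -> 0 <= chi^`() x) ->
  smooth_incr U f1 -> smooth_incr U f2 -> (forall x, U x -> f1 x <= f2 x) ->
  smooth_incr U (fun x => f1 x + chi x * (f2 x - f1 x)).
Proof.
move=> oU schi chi01 dchi0 [s1 p1] [s2 p2] f12; split=> [k|x Ux].
  by apply: kdiffD => //; apply: kdiffM => //; apply: kdiffB.
have d1 := smooth_on_is_derive s1 Ux; have d2 := smooth_on_is_derive s2 Ux.
have dchi := smooth_on_is_derive schi Ux.
rewrite (is_derive1E (is_deriveD d1 (is_deriveM dchi (is_deriveB d2 d1)))).
have convex0 : 0 < (1 - chi x) * f1^`()%classic x + chi x * f2^`()%classic x.
  have /andP[] := chi01 x Ux; rewrite le_eqVlt => /predU1P[<- _|chi0 chi1].
    by rewrite subr0 mul1r mul0r addr0 p1.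
  by rewrite ltr_wpDl ?mulr_gt0 ?p2 // mulr_ge0 ?subr_ge0 // ltW // p1.
have rest0 : 0 <= (f2 x - f1 x) * chi^`()%classic x.
  by rewrite mulr_ge0 ?subr_ge0 ?f12 ?dchi0.
by rewrite /GRing.scale !fctE /=; lra.
Qed.

Lemma smooth_incr_blend (U : set R) (a b : R) (f1 f2 : R -> R) : open U -> a < b ->
  smooth_incr (U `&` [set x | x < b]) f1 -> smooth_incr (U `&` [set x | a < x]) f2 ->
  (forall x, U x -> a <= x <= b -> f1 x <= f2 x) ->
  exists F, [/\ smooth_incr U F, forall x, x <= a -> F x = f1 x,
    forall x, b <= x -> F x = f2 x &
    forall x, U x -> a <= x <= b -> f1 x <= F x <= f2 x].
Proof.
move=> oU ab g1 g2 f12; pose u := a + (b - a) / 3; pose v := a + (b - a) * 2 / 3.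
have [au uv vb] : [/\ a < u, u < v & v < b] by rewrite /u /v; split; lra.
have [chi [schi chi01 dchi0 chi0 chi1]] := smooth_step_exists uv.
pose F x := f1 x + chi x * (f2 x - f1 x).
have FE1 x : x <= u -> F x = f1 x by move=> xu; rewrite /F chi0 // mul0r addr0.
have FE2 x : v <= x -> F x = f2 x by move=> vx; rewrite /F chi1 // mul1r addrC subrK.
exists F; split; last 3 first.
- by move=> x xa; apply: FE1; lra.
- by move=> x bx; apply: FE2; lra.
- by move=> x Ux /(f12 x Ux) f12x; have := chi01 x; rewrite /F; nra.
apply: smooth_incr_loc => x Ux; have [xu|ux] := ltP x u.
  exists [set x | x < u] => //; apply: (@smooth_incr_eq _ f1).
  - exact: openI.
  - by move=> y [/= yu _]; rewrite FE1 // ltW.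
  - by apply: smooth_incr_sub g1 => y [/= yu Uy]; split=> //=; lra.
have [vx|xv] := ltP v x.
  exists [set x | v < x] => //; apply: (@smooth_incr_eq _ f2).
  - exact: openI.
  - by move=> y [/= vy _]; rewrite FE2 // ltW.
  - by apply: smooth_incr_sub g2 => y [/= vy Uy]; split=> //=; lra.
exists [set x | a < x < b]; first by split=> //=; lra.
apply: smooth_incr_convex => //.
- exact: openI.
- by move=> k; apply: kdiff_sub (schi k).
- by apply: smooth_incr_sub g1 => y [/andP[_ yb] Uy].
- by apply: smooth_incr_sub g2 => y [/andP[ay _] Uy].
- by move=> y [/= ayb Uy]; apply: f12 => //; lra.
Qed.

Lemma smooth_incr_extend_left (b l : R) (h : R -> R) : 0 < l < b ->
  smooth_incr [set x | 0 < x < b] h -> (forall x, 0 < x < b -> 0 < h x) ->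
  exists F, [/\ smooth_incr [set x | x < b] F, F 0 = 0 & forall x, l <= x -> F x = h x].
Proof.
move=> lb gh h0; pose s := h (l / 2) / b.
have hl0 : 0 < h (l / 2) by apply: h0; lra.
have b0 : 0 < b by lra.
have s0 : 0 < s by rewrite divr_gt0.
have [|||||F [gF Fs Fh _]] :=
    @smooth_incr_blend [set x | x < b] (l / 2) l ( *%R s) h; rewrite //.
- lra.
- exact: smooth_incr_dilate.
- by apply: smooth_incr_sub gh => x [/=]; lra.
- move=> x /= xb lx; apply: (@le_trans _ _ (s * b)).
    by rewrite ler_pM2l // ltW.
  rewrite divfK ?gt_eqF //; apply: (smooth_incr_le gh); last lra.
  by move=> z /=; lra.
by exists F; split=> //; rewrite Fs ?mulr0 //; lra.
Qed.

(* A straight line above h and below the identity connects h to the identity. *)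
Lemma smooth_incr_extend_right (b r : R) (h : R -> R) : r < b ->
  smooth_incr [set x | x < b] h -> (forall x, r <= x < b -> h x < b) ->
  exists F, [/\ smooth_incr setT F, forall x, x <= r -> F x = h x &
    forall x, b <= x -> F x = x].
Proof.
move=> rb gh hb; pose m := (r + b) / 2.
have [rm mb] : r < m /\ m < b by rewrite /m; split; lra.
have hmb : h m < b by apply: hb; lra.
pose a := (b - h m) / 2 / (b - r); pose L x := a * x + (h m - a * r).
have Lb : L b = (h m + b) / 2.
  rewrite (_ : L b = a * (b - r) + h m); last by rewrite /L; ring.
  by rewrite divfK ?subr_eq0 ?gt_eqF //; lra.
have a0 : 0 < a by rewrite !divr_gt0 //; lra.
have gL := smooth_incr_affine _ (fun x => erefl (L x)) a0.
have L_le := smooth_incr_mono (gL setT).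
have [|||||F [gF Fh FL _]] := @smooth_incr_blend setT r m h L; rewrite //.
- by apply: smooth_incr_sub gh => x [_ /=]; lra.
- move=> x _ /andP[rx xm]; apply: (@le_trans _ _ (h m)).
    by apply: (smooth_incr_le gh) => // z /=; lra.
  by apply: (@le_trans _ _ (L r)); [rewrite /L; lra|rewrite L_le].
pose n := Num.max m (L b).
have [mn Ln] : m <= n /\ L b <= n by rewrite !le_max !lexx orbT.
have nb : n < b by rewrite gt_max mb /=; lra.
have [|||||G [gG GF Gid _]] := @smooth_incr_blend setT n b F id; rewrite //.
- exact: smooth_incr_sub gF.
- exact: smooth_incr_id.
- move=> x _ /andP[nx xb]; rewrite FL; last lra.
  by apply: le_trans nx; apply: le_trans Ln; rewrite L_le.
by exists G; split=> // x xr; rewrite GF ?Fh //; lra.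
Qed.

Lemma smooth_incr_extend (l r : R) (h : R -> R) : 0 < l -> l <= r -> r < 1 ->
  smooth_incr [set x | 0 < x < 1] h -> (forall x, 0 < x < 1 -> 0 < h x < 1) ->
  exists F, [/\ smooth_incr setT F, F 0 = 0, forall x, 1 <= x -> F x = x &
    forall x, l <= x <= r -> F x = h x].
Proof.
move=> l0 lr r1 gh h01.
have [||x /h01/andP[]//|F1 [gF1 F1_0 F1h]] := @smooth_incr_extend_left 1 l h; [lra|by []|].
have [||x rx1|F [gF FF1 F1']] := @smooth_incr_extend_right 1 r F1; rewrite //.
  have /andP[_ hx1] : 0 < h x < 1 by apply: h01; lra.
  by rewrite F1h //; lra.
exists F; split=> // [|x /andP[lx xr]]; first by rewrite FF1 //; lra.
by rewrite FF1 ?F1h.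
Qed.

End SmoothIncr.

(** * Diffeomorphisms of the unit interval *)

Section UnitInterval.
Context {R : realType}.
Let I := @unitI R.

Lemma clamp_le0 (x : R) : x <= 0 -> clamp x = I0.
Proof.
move=> x0; apply: Ival_inj; rewrite I0E /Ival /=.
by rewrite min_l ?max_l //; lra.
Qed.

Lemma clamp_ge1 (x : R) : 1 <= x -> clamp x = I1.
Proof.
move=> x1; apply: Ival_inj; rewrite I1E /Ival /=.
by rewrite min_r ?max_r //; lra.
Qed.

Lemma Ival_clamp_nondecreasing : {homo (fun x : R => Ival (clamp x)) : x y / x <= y}.
Proof. by move=> x y xy; rewrite /Ival /= ge_max !le_max lexx /= le_min2 ?orbT. Qed.

Lemma smooth_clamp (U : set R) (h : R -> R) : open U -> smooth_on U h ->
  [set x | 0 <= x <= 1] `<=` U -> (forall x, 0 <= x <= 1 -> 0 <= h x <= 1) ->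
  smooth_map (fun t : I => clamp (h (Ival t))).
Proof.
move=> oU sh IU hI n q pq; have oq := plot_open pq.
have qI w : pdom q w -> 0 <= qval q w <= 1.
  by rewrite /pdom /qval /=; case: (q w) => // t _; exact: Ival_bound.
have phq : plot (prestr (pdom q) (fun w => Some (clamp (h (qval q w))))).
  apply: unitI_plot => // [k|w /qI]; last exact: hI.
  apply: (@kdiff_comp1 _ _ _ _ U (qval q)) => //; first by move=> w /qI/IU.
  exact: qval_smooth.
apply: plot_ext phq _ _; apply/funext => w; rewrite /prestr /qval /pdom /=.
by case: (q w) => [t|] /=; [rewrite asboolT|rewrite asboolF].
Qed.

Lemma flip_smooth : smooth_map (fun t : I => clamp (1 - Ival t)).
Proof.
apply: (@smooth_clamp setT (fun x => 1 - x)) => // [k|x]; last lra.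
by apply: kdiffB => //; [exact: kdiff_cst|exact: kdiff_id].
Qed.

Definition real_ext (f : I -> I) (x : R) : R := Ival (f (clamp x)).

Lemma real_extK (f g : I -> I) : cancel f g ->
  {in `[0, 1]%R, cancel (real_ext f) (real_ext g)}.
Proof. by move=> fK x; rewrite in_itv /real_ext IvalK fK => /clampK. Qed.

Lemma real_ext_smooth (f : I -> I) (U : set R) (s : R -> R) : smooth_map f -> open U ->
  smooth_on U s -> (forall x, U x -> 0 <= s x <= 1) ->
  smooth_on U (fun x => real_ext f (s x)).
Proof.
move=> sf oU ss sI; pose W := [set r : 'rV[R]_1 | U (r 0 0)].
have scoord : smooth_on setT (fun r : 'rV[R]_1 => r 0 0).
  by move=> k; apply: (@kdiff_coord _ _ _ _ _ _ idfun) => //; exact: kdiff_id.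
have oW : open W by have := open_preim_smooth openT scoord oU; rewrite setTI.
have pW : plot (prestr W (fun r : 'rV[R]_1 => Some (clamp (s (r 0 0))))).
  apply: unitI_plot => // [k|w]; last exact: sI.
  by apply: (@kdiff_comp1 _ _ _ _ U) => //; exact: kdiff_sub (scoord k).
have [_ sW] := sf _ _ pW; move=> k.
have kW : kdiff k W (fun r : 'rV[R]_1 => real_ext f (s (r 0 0))).
  have domW : W `&` pdom (fun r : 'rV[R]_1 => Some (clamp (s (r 0 0)))) = W.
    by apply/seteqP; split=> [r []|r].
  have := sW k; rewrite !pdom_omap pdom_restr domW.
  by apply: kdiff_eq oW _ => r Wr; rewrite /= prestrT.
have rVE (x : R) : (x *: const_mx 1 : 'rV[R]_1) 0 0 = x by rewrite !mxE mulr1.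
have kU : kdiff k U (fun x => real_ext f (s ((x *: const_mx 1 : 'rV[R]_1) 0 0))).
  apply: (@kdiff_comp_real R R 1 k U W (fun x => x *: const_mx 1)
    (fun r => real_ext f (s (r 0 0)))) => // [x|]; first by rewrite /W /= rVE.
  by apply: (@kdiff_scalel _ _ _ _ _ idfun) => //; exact: kdiff_id.
by apply: kdiff_eq oU _ kU => x _; rewrite rVE.
Qed.

(* Near 0, a smooth map of [0, 1] is only known through plots such as x |-> x^2,
   of which the square root is a continuous section. *)
Lemma real_ext_continuous_lt1 (f : I -> I) x :
  smooth_map f -> x < 1 -> {for x, continuous (real_ext f)}.
Proof.
move=> sf x1; have sqr_bound (y : R) : -1 < y < 1 -> 0 <= y * y <= 1.
  by move=> y1; apply/andP; split; nra.
have sfsqr : smooth_on [set y : R | -1 < y < 1] (fun y => real_ext f (y * y)).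
  apply: real_ext_smooth => // k; by apply: kdiffM => //; exact: kdiff_id.
have extE y : real_ext f y = real_ext f (Num.sqrt y * Num.sqrt y).
  have [y0|y0] := leP y 0; last by rewrite -expr2 sqr_sqrtr ?ltW.
  by rewrite ler0_sqrtr // mulr0 /real_ext !clamp_le0.
rewrite (_ : real_ext f = (fun y => real_ext f (y * y)) \o Num.sqrt); last first.
  by apply/funext => y; exact: extE.
apply: continuous_comp; first exact: sqrt_continuous.
apply: smooth_continuous sfsqr _; apply/andP; split.
  by apply: lt_le_trans (sqrtr_ge0 _); lra.
by rewrite -sqrtr1 ltr_sqrt.
Qed.

Lemma real_ext_continuous (f : I -> I) : smooth_map f -> continuous (real_ext f).
Proof.
move=> sf x; have [x1|x1] := ltP x 1; first exact: real_ext_continuous_lt1.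
rewrite (_ : real_ext f =
    real_ext (f \o (fun t : I => clamp (1 - Ival t))) \o (fun y => 1 - y)).
  apply: continuous_comp; first by apply: continuousB; [exact: cst_continuous|].
  by apply: real_ext_continuous_lt1; [exact: smooth_comp flip_smooth|lra].
apply/funext => y; rewrite /real_ext !compE; congr (Ival (f _)).
have [y0|y0] := leP y 0.
  by rewrite (clamp_ge1 (x := 1 - y)) ?I1E ?subrr ?clamp_le0 //; lra.
have [y1|y1] := leP 1 y.
  by rewrite (clamp_le0 (x := 1 - y)) ?I0E ?subr0 ?clamp_ge1 //; lra.
by rewrite (clampK (x := 1 - y)) ?subKr //; lra.
Qed.

Definition unit_diffeo (f g : smap I I) :=
  [/\ cancel (sval f) (sval g), cancel (sval g) (sval f), sval f I0 = I0 & sval f I1 = I1].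

Lemma smooth_incr_unit_diffeo (F : R -> R) : smooth_incr setT F -> F 0 = 0 -> F 1 = 1 ->
  exists f g : smap I I, unit_diffeo f g /\ forall t, Ival (sval f t) = F (Ival t).
Proof.
move=> gF F0 F1; have [G FK sG] := smooth_incr_inverse gF.
have FI x : 0 <= x <= 1 -> 0 <= F x <= 1.
  by rewrite -{2}F0 -{2}F1 !(smooth_incr_mono gF).
have preI x : 0 <= x <= 1 -> exists2 c, 0 <= c <= 1 & F c = x.
  by move=> x01; apply: smooth_incr_IVT => //; rewrite F0 F1.
have sf : smooth_map (fun t : I => clamp (F (Ival t))).
  exact: smooth_clamp openT gF.1 (@subsetT _ _) FI.
have sg : smooth_map (fun t : I => clamp (G (Ival t))).
  apply: smooth_clamp (smooth_incr_open_range gF) sG _ _ => x /preI[c c01 <-].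
    by exists c.
  by rewrite FK.
have fE t : Ival (clamp (F (Ival t))) = F (Ival t) by rewrite clampK // FI // Ival_bound.
exists (exist _ _ sf), (exist _ _ sg); split; last by [].
split=> [t|t||].
- by rewrite -[LHS]/(clamp (G (Ival (clamp (F (Ival t)))))) fE FK IvalK.
- rewrite -[LHS]/(clamp (F (Ival (clamp (G (Ival t)))))).
  by have [c c01 Fc] := preI _ (Ival_bound t); rewrite -Fc FK clampK // Fc IvalK.
- by apply: Ival_inj; rewrite [LHS]fE I0E F0.
- by apply: Ival_inj; rewrite [LHS]fE I1E F1.
Qed.

Section UnitDiffeo.
Variables (f g : smap I I).
Hypothesis fg : unit_diffeo f g.

Lemma unit_diffeo_ext0 : real_ext (sval f) 0 = 0.
Proof. by have [_ _ f0 _] := fg; rewrite /real_ext -/I0 f0 I0E. Qed.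

Lemma unit_diffeo_ext1 : real_ext (sval f) 1 = 1.
Proof. by have [_ _ _ f1] := fg; rewrite /real_ext -/I1 f1 I1E. Qed.

Lemma unit_diffeo_mono : {in `[0, 1]%R &, {mono real_ext (sval f) : x y / x <= y}}.
Proof.
have [fK _ _ _] := fg; apply: segment_continuous_inj_le.
- by rewrite unit_diffeo_ext0 unit_diffeo_ext1.
- by apply: continuous_subspaceT; exact: real_ext_continuous (svalP f).
- exact: can_in_inj (real_extK fK).
Qed.

Lemma unit_diffeo_nondecreasing : {homo real_ext (sval f) : x y / x <= y}.
Proof.
move=> x y /Ival_clamp_nondecreasing.
by rewrite -unit_diffeo_mono ?in_itv ?Ival_bound // /real_ext !IvalK.
Qed.

Lemma unit_diffeo_lt : {in `[0, 1]%R &, {mono real_ext (sval f) : x y / x < y}}.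
Proof. exact: leW_mono_in unit_diffeo_mono. Qed.

Lemma unit_diffeo_ext_oo x : 0 < x < 1 -> 0 < real_ext (sval f) x < 1.
Proof.
move=> x01; rewrite -unit_diffeo_ext0 -unit_diffeo_ext1.
by rewrite !unit_diffeo_lt ?in_itv /=; lra.
Qed.

Lemma unit_diffeo_smooth_incr : smooth_incr [set x | 0 < x < 1] (real_ext (sval f)).
Proof.
have [fK _ _ _] := fg; set U := [set x | _]; have oU : open U by [].
have ext_smooth (h : smap I I) : smooth_on U (real_ext (sval h)).
  apply: (@real_ext_smooth _ U id (svalP h)) => // [k|x /andP[x0 x1]].
    exact: kdiff_id.
  by rewrite !ltW.
split=> // x Ux.
have df := smooth_on_is_derive (ext_smooth f) Ux.
have dg := smooth_on_is_derive (ext_smooth g) (unit_diffeo_ext_oo Ux).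
have dgf : is_derive x 1 (real_ext (sval g) \o real_ext (sval f)) 1.
  apply: (@near_eq_is_derive _ _ _ id).
  apply: filterS (open_nbhs_nbhs (conj oU Ux)) => y /andP[y0 y1] /=.
  by rewrite real_extK // in_itv /= !ltW.
have gf1 : (real_ext (sval g))^`()%classic (real_ext (sval f) x) *
    (real_ext (sval f))^`()%classic x = 1.
  by rewrite -(is_derive1E (is_derive1_comp dg df)) (is_derive1E dgf).
have df_ge0 : 0 <= (real_ext (sval f))^`() x.
  apply: (@incr_derive1_ge0_itv R _ true false 0 1) => [y|y z|].
  - move=> /set_mem /=; rewrite in_itv /= => Uy.
    by case: (smooth_on_is_derive (ext_smooth f) Uy).
  - by move=> y01 z01; rewrite unit_diffeo_lt //; exact: subset_itv_oo_cc.
  - by rewrite in_itv.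
rewrite lt_neqAle df_ge0 andbT eq_sym; apply/eqP => df0.
by move: gf1; rewrite df0 mulr0; lra.
Qed.

End UnitDiffeo.

Lemma unit_diffeo_sym (f g : smap I I) : unit_diffeo f g -> unit_diffeo g f.
Proof.
by move=> [fK gK f0 f1]; split=> //; [rewrite -[in LHS]f0 fK|rewrite -[in LHS]f1 fK].
Qed.

End UnitInterval.

(** * Changes of parameter of concatenations *)

Section Reparam.
Context {R : realType}.
Variable X : diffSpace R.
Let I := @unitI R.
Implicit Types a b c u v : Cinf X.

Lemma catf_lt (b a : I -> X) (x : R) : x < 2^-1 -> catf b a (clamp x) = a (clamp (2 * x)).
Proof.
move=> x2; have [x0|x0] := leP x 0; first by rewrite !clamp_le0 ?catf0 //; lra.
by rewrite /catf clampK ?x2 //; lra.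
Qed.

Lemma catf_ge (b a : I -> X) (x : R) :
  2^-1 <= x -> catf b a (clamp x) = b (clamp (2 * x - 1)).
Proof.
move=> x2; have [x1|x1] := leP 1 x; first by rewrite !clamp_ge1 ?catf1 //; lra.
by rewrite /catf clampK ?ltNge ?x2 //; lra.
Qed.

Lemma cst_near_ends_clamp (a : I -> X) : cst_near_ends a ->
  exists2 e : R, 0 < e <= 2^-1 & forall x, (x < e -> a (clamp x) = a I0) /\
    (1 - e < x -> a (clamp x) = a I1).
Proof.
move=> [d d0 ad]; pose e := Num.min d 2^-1.
have [ed e2] : e <= d /\ e <= 2^-1 by rewrite !ge_min !lexx orbT.
have e0 : 0 < e by rewrite lt_min d0; lra.
exists e; [by rewrite e0|move=> x; split=> xe].
- have [x0|x0] := leP x 0; first by rewrite clamp_le0.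
  by apply: (ad _).1; rewrite clampK; lra.
- have [x1|x1] := leP 1 x; first by rewrite clamp_ge1.
  by apply: (ad _).2; rewrite clampK; lra.
Qed.

Lemma reparam_sym a b : reparam a b -> reparam b a.
Proof.
move=> [f [g [fK gK f0 f1 ab]]].
have [gK' fK' g0 g1] := unit_diffeo_sym (And4 fK gK f0 f1).
by exists g, f; split=> //; apply/funext => t; rewrite ab /= gK.
Qed.

Lemma reparam_trans b a c : reparam a b -> reparam b c -> reparam a c.
Proof.
move=> [f [g [fK gK f0 f1 ab]]] [f' [g' [fK' gK' f0' f1' bc]]].
exists (comp_map f' f), (comp_map g g'); split=> //=.
- exact: can_comp fK' fK.
- exact: can_comp gK gK'.
- by rewrite f0.
- by rewrite f1.
- by rewrite ab bc.
Qed.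

Lemma smooth_incr_reparam (F : R -> R) a b : smooth_incr setT F -> F 0 = 0 -> F 1 = 1 ->
  (forall x, 0 <= x <= 1 -> sval a (clamp x) = sval b (clamp (F x))) -> reparam a b.
Proof.
move=> gF F0 F1 ab; have [f [g [[fK gK f0 f1] fE]]] := smooth_incr_unit_diffeo gF F0 F1.
exists f, g; split=> //; apply/funext => t /=.
by rewrite -[X in sval b X]IvalK fE -ab ?IvalK // Ival_bound.
Qed.

(* Where b is constant the change of parameter may be modified at will: F is the
   identity beyond 1, so that it can act on the first half of a concatenation. *)
Lemma reparam_smooth_incr a b : cst_near_ends (sval b) -> reparam a b ->
  exists F, [/\ smooth_incr setT F, F 0 = 0, forall x, 1 <= x -> F x = x &
    forall x, sval a (clamp x) = sval b (clamp (F x))].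
Proof.
move=> /cst_near_ends_clamp[e e01 be] [f [g [fK gK f0 f1 ab]]].
have fg : unit_diffeo f g by [].
pose h := real_ext (sval f); pose l := real_ext (sval g) (e / 2).
pose r := real_ext (sval g) (1 - e / 2).
have hl : h l = e / 2 by apply: (real_extK gK); rewrite in_itv /=; lra.
have hr : h r = 1 - e / 2 by apply: (real_extK gK); rewrite in_itv /=; lra.
have l01 : 0 < l < 1 by apply: (unit_diffeo_ext_oo (unit_diffeo_sym fg)); lra.
have r01 : 0 < r < 1 by apply: (unit_diffeo_ext_oo (unit_diffeo_sym fg)); lra.
have lr : l <= r by apply: (unit_diffeo_nondecreasing (unit_diffeo_sym fg)); lra.
have [||F [gF F0 F1 Fh]] := smooth_incr_extend _ lr _
  (unit_diffeo_smooth_incr fg) (fun x => unit_diffeo_ext_oo fg (x := x)); [lra|lra|].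
exists F; split=> // x; rewrite ab.
transitivity (sval b (clamp (h x))); first by rewrite /h /real_ext IvalK.
have Fl : F l = e / 2 by rewrite Fh // lexx.
have Fr : F r = 1 - e / 2 by rewrite Fh // lexx lr.
have [xl|lx] := leP x l.
  have := unit_diffeo_nondecreasing fg xl; rewrite -/h hl => hx.
  have : F x <= F l by rewrite smooth_incr_mono.
  by rewrite Fl => Fx; rewrite !(be _).1 //; lra.
have [rx|xr] := leP r x; last by rewrite Fh // !ltW.
have := unit_diffeo_nondecreasing fg rx; rewrite -/h hr => hx.
have : F r <= F x by rewrite smooth_incr_mono.
by rewrite Fr => Fx; rewrite !(be _).2 //; lra.
Qed.

Definition is_cat c a u := [/\ cst_near_ends (sval c), cst_near_ends (sval a),
  sval c I0 = sval a I1 & sval u = catf (sval c) (sval a)].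

Lemma is_cat_exists c a : cst_near_ends (sval c) -> cst_near_ends (sval a) ->
  sval c I0 = sval a I1 -> exists u, is_cat c a u.
Proof. by move=> hc ha ca; exists (Defs.cat hc ha ca). Qed.

Lemma is_cat_cst_near_ends c a u : is_cat c a u -> cst_near_ends (sval u).
Proof. by move=> [hc ha _ ->]; exact: catf_ends. Qed.

Lemma is_cat_start c a u : is_cat c a u -> sval u I0 = sval a I0.
Proof. by move=> [_ _ _ ->]; exact: catf0. Qed.

Lemma is_cat_end c a u : is_cat c a u -> sval u I1 = sval c I1.
Proof. by move=> [_ _ _ ->]; exact: catf1. Qed.

Lemma reparam_cat c a b u v : is_cat c a u -> is_cat c b v -> reparam a b -> reparam u v.
Proof.
move=> [_ _ _ uE] [_ hb _ vE] /(reparam_smooth_incr hb)[F [gF F0 F1 ab]].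
apply: (@smooth_incr_reparam (fun x => 2^-1 * F (2 * x))) => [||//|x _].
- apply: (@smooth_incr_comp _ _ setT (fun x => F (2 * x)) ( *%R 2^-1)) => //.
    by apply: (@smooth_incr_comp _ _ setT ( *%R 2) F) => //; apply: smooth_incr_dilate.
  by apply: smooth_incr_dilate; lra.
- by rewrite mulr0 F0 mulr0.
- by rewrite F1; lra.
rewrite uE vE; have [x2|x2] := ltP x 2^-1.
  have Fx2 : F (2 * x) < 1.
    by rewrite -[ltRHS]F1 // (leW_mono (smooth_incr_mono gF)); lra.
  rewrite !catf_lt; [|lra..].
  by rewrite ab; congr (sval b (clamp _)); lra.
have -> : 2^-1 * F (2 * x) = x by rewrite F1; lra.
by rewrite !catf_ge.
Qed.

(* Reparametrizes along x/2, then x - 1/4 from x = 1/2, then 2x - 1 from x = 3/4. *)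
Lemma reparam_catA c b a cb ba u v :
  is_cat c b cb -> is_cat cb a u -> is_cat b a ba -> is_cat c ba v -> reparam u v.
Proof.
move=> [hc hb _ cbE] [_ _ _ uE] [_ _ _ baE] [_ _ _ vE].
have [d d01 cd] := cst_near_ends_clamp hc; have [e e01 be] := cst_near_ends_clamp hb.
have [|||||F [gF F1 F2 F12]] := @smooth_incr_blend R setT 2^-1 (2^-1 + e / 8)
    ( *%R 2^-1) (fun x => x - 4^-1); rewrite //; first lra.
- by apply: smooth_incr_dilate; lra.
- by apply: (@smooth_incr_affine _ _ _ 1 (- 4^-1)); [move=> x; rewrite mul1r|lra].
- by move=> x _; lra.
have [|||||G [gG GF G2 G12]] := @smooth_incr_blend R setT (3 / 4) (3 / 4 + d / 8)
    F (fun x => 2 * x - 1); rewrite //; first lra.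
- by apply: smooth_incr_sub gF.
- exact: (@smooth_incr_affine _ _ _ 2 (-1)).
- by move=> x _ h; rewrite F2; lra.
apply: (smooth_incr_reparam gG); [by rewrite GF ?F1; lra|by rewrite G2; lra|].
move=> x _; rewrite uE vE; have [x1|x1] := ltP x 2^-1.
  rewrite catf_lt // GF ?F1; [|lra..].
  by rewrite catf_lt ?baE ?catf_lt; [congr (sval a (clamp _))|..]; lra.
rewrite catf_ge // cbE; have [x2|x2] := ltP x (3 / 4).
  rewrite GF ?[in LHS]catf_lt; [|lra..].
  have [x3|x3] := ltP x (2^-1 + e / 8); last first.
    rewrite F2 // catf_lt ?baE ?catf_ge; [|lra..].
    by congr (sval b (clamp _)); lra.
  have /andP[Fx1 Fx2] : 2^-1 * x <= F x <= x - 4^-1 by apply: F12 => //; lra.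
  by rewrite catf_lt ?baE ?catf_ge ?(be _).1 //; lra.
rewrite [in LHS]catf_ge; last lra.
have [x3|x3] := ltP x (3 / 4 + d / 8); last first.
  by rewrite G2 // catf_ge; [congr (sval c (clamp _))|]; lra.
have /andP[] : F x <= G x <= 2 * x - 1 by apply: G12 => //; lra.
by rewrite F2 => [Gx1 Gx2|]; [rewrite catf_ge ?(cd _).1 //|]; lra.
Qed.

(* Reparametrizes along x/2, then x near x = 1. *)
Lemma reparam_cst_cat c b u : is_cat c b u -> (forall t, sval c t = sval b I1) ->
  reparam b u.
Proof.
move=> [_ hb _ uE] cE; have [e e01 be] := cst_near_ends_clamp hb.
have [|||||F [gF F1 F2 F12]] :=
    @smooth_incr_blend R setT (1 - e) 1 ( *%R 2^-1) id; rewrite //; first lra.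
- by apply: smooth_incr_dilate; lra.
- exact: smooth_incr_id.
- by move=> x _ /=; lra.
apply: (smooth_incr_reparam gF); [by rewrite F1 ?mulr0; lra|by rewrite F2|].
move=> x x01; rewrite uE; have [xe|ex] := leP x (1 - e).
  by rewrite F1 // catf_lt; [congr (sval b (clamp _))|]; lra.
have /andP[Fx _] : 2^-1 * x <= F x <= x by apply: F12 => //; lra.
rewrite (be x).2 //; have [Fx2|Fx2] := ltP (F x) 2^-1; last by rewrite catf_ge // cE.
by rewrite catf_lt // (be _).2 //; lra.
Qed.

End Reparam.

(** * Concatenation of retrace classes *)

Section Retrace.
Context {R : realType}.
Variable X : diffSpace R.
Let I := @unitI R.
Implicit Types a b c e p q u v : Cinf X.
Local Notation cls := (qcls (@reparam R X)).

Lemma eq_qcls (Y : diffSpace R) (r : Y -> Y -> Prop) (x y : Y) :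
  (forall x y, r x y -> r y x) -> (forall y x z, r x y -> r y z -> r x z) ->
  r x y -> qcls r x = qcls r y.
Proof.
move=> rsym rtrans xy; apply: eq_exist; apply/funext => z; apply/propext.
by split; apply: rtrans => //; exact: rsym.
Qed.

Lemma eq_cls a b : reparam a b -> cls a = cls b.
Proof. exact: eq_qcls (@reparam_sym R X) (@reparam_trans R X). Qed.

Lemma eq_Fcls a b : retrace (cls a) (cls b) -> Fcls a = Fcls b.
Proof. by apply: eq_qcls => [x y|y x z]; [exact: rst_sym|exact: rst_trans]. Qed.

Definition rev_path a : Cinf X := comp_map a (exist _ _ flip_smooth : smap I I).

Lemma rev_path_start a : sval (rev_path a) I0 = sval a I1.
Proof. by rewrite -[LHS]/(sval a (clamp (1 - Ival I0))) I0E subr0. Qed.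

Lemma rev_path_end a : sval (rev_path a) I1 = sval a I0.
Proof. by rewrite -[LHS]/(sval a (clamp (1 - Ival I1))) I1E subrr. Qed.

Lemma rev_path_cst_near_ends a :
  cst_near_ends (sval a) -> cst_near_ends (sval (rev_path a)).
Proof.
move=> [d d0 ad]; exists d => // t; have t01 := Ival_bound t.
rewrite rev_path_start rev_path_end -[sval _ t]/(sval a (clamp (1 - Ival t))).
by split=> td; [apply: (ad _).2|apply: (ad _).1]; rewrite clampK; lra.
Qed.

Lemma retrace_stepP (x y : Cinf_sim X) : retrace_step x y <->
  exists b e a ra era p q, [/\ is_cat b a p, is_cat (rev_path e) a ra, is_cat e ra era,
    is_cat b era q & x = cls p /\ y = cls q].
Proof.
split=> [[b [e [a [p [q [[hb he ha] ba ea [pE qE] xy]]]]]]|].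
  have hr := rev_path_cst_near_ends he.
  have [ra raE] := is_cat_exists hr ha (etrans (rev_path_start e) ea).
  have era0 : sval e I0 = sval ra I1 by rewrite (is_cat_end raE) rev_path_end.
  have [era eraE] := is_cat_exists he (is_cat_cst_near_ends raE) era0.
  exists b, e, a, ra, era, p, q; split=> //; split=> //.
  - exact: is_cat_cst_near_ends eraE.
  - by rewrite (is_cat_end eraE) ea.
  - by have [_ _ _ ->] := eraE; have [_ _ _ ->] := raE.
move=> [b [e [a [ra [era [p [q [bap rara eera bq xy]]]]]]]].
have [[hb ha ba pE] [_ _ ea raE]] := (bap, rara).
have [[he _ _ eraE] [_ _ _ qE]] := (eera, bq).
exists b, e, a, p, q; split=> //; first by rewrite -ea rev_path_start.
by rewrite qE eraE raE.
Qed.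

(* The classes [c \/ a] for all the paths a of class x that end where c starts:
   there is exactly one, or none. *)
Definition cat_classes c (x : Cinf_sim X) : set (Fspace X) :=
  [set z | exists a u, [/\ x = cls a, is_cat c a u & z = Fcls u]].

Lemma cat_classes_cls c a u : is_cat c a u -> cat_classes c (cls a) = [set Fcls u].
Proof.
move=> cau; apply/seteqP; split=> [_ [b [v [ab cbv ->]]]|_ ->]; last by exists a, u.
by rewrite /= /Fcls (eq_cls (reparam_cat cau cbv (qclsP (@reparam_refl R X) ab))).
Qed.

Lemma cat_classes_eq0 c a :
  ~ (cst_near_ends (sval c) /\ sval c I0 = sval a I1) -> cat_classes c (cls a) = set0.
Proof.
move=> nca; apply/seteqP; split=> // z [b [u [ab [hc _ cb _] _]]].
by case: nca; rewrite cb (reparam_end (qclsP (@reparam_refl R X) ab)).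
Qed.

Lemma cat_classes_retrace_step c x y :
  retrace_step x y -> cat_classes c x = cat_classes c y.
Proof.
move=> /retrace_stepP[b [e [a [ra [era [p [q [bap rara eera bq [-> ->]]]]]]]]].
have [[hc cb]|ncb] := pselect (cst_near_ends (sval c) /\ sval c I0 = sval b I1); last first.
  by rewrite !cat_classes_eq0 // ?(is_cat_end bap) ?(is_cat_end bq).
have [u cpu] : exists u, is_cat c p u.
  by apply: is_cat_exists; rewrite ?(is_cat_end bap) //; exact: is_cat_cst_near_ends bap.
have [v cqv] : exists v, is_cat c q v.
  by apply: is_cat_exists; rewrite ?(is_cat_end bq) //; exact: is_cat_cst_near_ends bq.
rewrite (cat_classes_cls cpu) (cat_classes_cls cqv); congr [set _]; apply: eq_Fcls.
have [hb ha ba _] := bap; have [_ hera bera _] := bq.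
have [cb' cbE] := is_cat_exists hc hb cb.
have hcb := is_cat_cst_near_ends cbE; have cb0 := is_cat_start cbE.
have [u' cbau] := is_cat_exists hcb ha (etrans cb0 ba).
have [v' cberav] := is_cat_exists hcb hera (etrans cb0 bera).
rewrite -(eq_cls (reparam_catA cbE cbau bap cpu)).
rewrite -(eq_cls (reparam_catA cbE cberav bq cqv)).
by apply/rst_step/retrace_stepP; exists cb', e, a, ra, era, u', v'.
Qed.

Lemma cat_classes_retrace c x y : retrace x y -> cat_classes c x = cat_classes c y.
Proof.
elim=> {x y} [x y|x|x y _ ->|x y z _ -> _ ->] //.
exact: cat_classes_retrace_step.
Qed.

Lemma Fcls_cat c a b u v :
  is_cat c a u -> is_cat c b v -> Fcls a = Fcls b -> Fcls u = Fcls v.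
Proof.
move=> cau cbv /(qclsP (@retrace_refl R X))/(cat_classes_retrace c).
rewrite (cat_classes_cls cau) (cat_classes_cls cbv) => uv.
by have : [set Fcls u] (Fcls u) by []; rewrite uv.
Qed.

End Retrace.

(** * Transport along a path *)

Section Transport.
Context {R : realType}.
Variables (X : diffSpace R) (x0 : X) (phi : flattening R).

Section Start.
Variables (c : smooth_path X) (r : R) (b : Cinf X) (hb : based x0 b).
Hypothesis hr : c r = Some (sval b I1).

Lemma flat_concat_is_cat s (hs : pdom c s) :
  is_cat (flat_seg phi hr hs) b (flat_concat phi hb hr hs).
Proof. by split=> //; [exact: flat_seg_ends|exact: hb.1|exact: flat_seg0]. Qed.

Lemma transport_start (hs : pdom c r) :
  class_of_based (flat_concat_based phi hb hr hs) = class_of_based hb.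
Proof.
apply: eq_exist; apply: esym; congr qcls; apply: eq_cls.
apply: reparam_cst_cat (flat_concat_is_cat hs) _ => t.
by apply: oval_eq; rewrite -hr; congr (path_fun c _); ring.
Qed.

Lemma transport_lift : lift_at tau c r (class_of_based hb) (transport phi hb hr).
Proof.
have [_ _ phi1] := svalP phi; split.
  apply/funext => s; rewrite /= /transport_fun; case: pselect => [hs|] /=.
    rewrite tau_class /= catf1 /= phi1 /seg_fun ovalE I1E.
    by rewrite mul1r subrr mul0r addr0.
  by rewrite /pdom /=; case: (c s).
rewrite /= /transport_fun; case: pselect => [hs|[]]; first by rewrite transport_start.
by rewrite /pdom /= hr.
Qed.

End Start.

Lemma transport_eq (c c' : smooth_path X) (r : R) (b b' : Cinf X)
    (hb : based x0 b) (hb' : based x0 b')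
    (hr : c r = Some (sval b I1)) (hr' : c' r = Some (sval b' I1)) :
  c = c' -> Fcls b = Fcls b' -> transport phi hb hr = transport phi hb' hr'.
Proof.
move=> cc'; case: c' / cc' hr' => hr' bb'; apply: path_eq => s /=.
rewrite /transport_fun; case: pselect => // hs; congr Some; apply: eq_exist.
have segE : flat_seg phi hr hs = flat_seg phi hr' hs.
  apply: eq_exist; apply/funext => t; apply: oval_eq.
  exact: esym (ovalE _).
have := flat_concat_is_cat hb hr hs; rewrite segE => cat_b.
exact: Fcls_cat cat_b (flat_concat_is_cat hb' hr' hs) bb'.
Qed.

Lemma Theta_lift (c : smooth_path X) (r : R) (b : Cinf X) (hb : based x0 b)
    (hr : c r = Some (sval b I1)) (l : smooth_path (pointedF x0)) (lr : pdom l r) :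
  lift_at tau c r (class_of_based hb) l ->
  Theta phi (exist _ (l, r) lr) = transport phi hb hr.
Proof.
move=> [lc l_r]; apply: transport_eq; first by apply: path_eq => t; rewrite -lc.
have -> : theta_start (exist _ (l, r) lr) = class_of_based hb by exact: oval_eq.
exact: (congr1 sval (repK (class_of_based hb))).
Qed.

End Transport.

Theorem proposition3p12 (R : realType) (X : diffSpace R) (pt : X)
    (Xconn : path_connected X) (phi : flattening R)
    (alpha : smooth_path X) (t0 : R) (ht0 : pdom alpha t0)
    (beta0 : Cinf X) (hbeta0 : based pt beta0)
    (hfib : alpha t0 = Some (tau (class_of_based hbeta0))) :
  is_hor tau (Theta phi) alpha t0 (class_of_based hbeta0) (alpha_bar phi hfib).
Proof.
have lift : lift_at tau alpha t0 (class_of_based hbeta0) (alpha_bar phi hfib).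
  exact: transport_lift.
have dom : pdom (alpha_bar phi hfib) t0 by exact: (congr1 isSome lift.2).
split=> [||l lt0 l_lift]; last exact: Theta_lift.
- by exists t0, dom; exact: Theta_lift.
- by exists (alpha_bar phi hfib).
Qed.
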